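(* Let $k \geq 3$. Given a $k$-SAT instance $F$ on $n$ variables and a $\delta \in [0, H(1/k)]$ with the guarantee that $|\mathrm{sat}(F)| \geq 2^{\delta n}$, one can find a satisfying assignment for $F$ (by a randomized algorithm) in expected time $$O^*\left(\left(\frac{2(k-1)}{k}\right)^{n}\cdot (k-1)^{-H^{-1}(\delta) n}\right).$$
   Context: $\mathrm{sat}(F)$ denotes the set of assignments of the $n$ variables of $F$ to $\{0,1\}$ that satisfy every clause of the $k$-CNF formula $F$. $H:[0,1]\to[0,1]$ is the binary entropy function $H(x) = -x\log_2 x - (1-x)\log_2(1-x)$ with $H(0)=H(1)=0$, and $H^{-1}:[0,1]\to[0,1/2]$ is the inverse of $H$ restricted to $[0,1/2]$. $O^*(\cdot)$ suppresses factors polynomial in the input size. *)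

(* Defs.v *)
From HB Require Import structures.
From mathcomp Require Import all_boot all_order all_algebra.
From mathcomp Require Import all_classical all_reals all_analysis.
Set Implicit Arguments.
Unset Strict Implicit.
Unset Printing Implicit Defensive.
Import Order.TTheory GRing.Theory Num.Theory.
Local Open Scope ring_scope.

(** * CNF formulas *)

(* [(i, b)] is the literal satisfied by the assignments giving [i] the
   value [b]: [x_i] if [b = true], its negation otherwise. *)
Definition literal (n : nat) : Type := ('I_n * bool)%type.
Definition clause (n : nat) : Type := seq (literal n).
Definition cnf (n : nat) : Type := seq (clause n).
Definition assignment (n : nat) : Type := {ffun 'I_n -> bool}.

Definition is_kcnf (k n : nat) (F : cnf n) : bool :=
  all (fun C : clause n => (size C <= k)%N) F.

Definition satisfies (n : nat) (a : assignment n) (F : cnf n) : bool :=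
  all (fun C : clause n => has (fun l : literal n => a l.1 == l.2) C) F.

Definition sat (n : nat) (F : cnf n) : {set {ffun 'I_n -> bool}} :=
  [set a : {ffun 'I_n -> bool} | satisfies a F].

(** * Binary entropy *)

Definition log2 (R : realType) (x : R) : R := ln x / ln 2.

(* [ln 0 = 0] in the library, so the usual convention H(0) = H(1) = 0 is
   given by the formula itself. *)
Definition entropy (R : realType) (x : R) : R :=
  - x * log2 x - (1 - x) * log2 (1 - x).

(* The value outside the image of [0, 1/2] is 0 and is irrelevant. *)
Definition entropy_inv (R : realType) : R -> R :=
  'pinv_(fun=> 0) (`[0, 2^-1]%classic : set R) (@entropy R).

(** * Randomized programs *)

(* The machine model is the imperative language WHILE of N. D. Jones
   (Computability and Complexity, 1997) with an additional fair coin toss.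
   Data are binary trees.  A tree is only built by a single [cons], inspected
   at its root and copied by reference, hence, with shared subtrees, every
   step is simulated by a bounded number of pointer operations; this makes
   the number of steps polynomially related to Turing machine time. *)
Inductive tree : Type :=
| Leaf : tree
| Node : tree -> tree -> tree.

Inductive expr : Type :=
| EVar : nat -> expr
| ENil : expr
| ECons : expr -> expr -> expr
| EHead : expr -> expr
| ETail : expr -> expr.

Inductive cmd : Type :=
| Assign : nat -> expr -> cmd
| Toss : nat -> cmd
| Then : cmd -> cmd -> cmd
| If : expr -> cmd -> cmd -> cmd
| While : expr -> cmd -> cmd.

Definition store : Type := nat -> tree.

Definition update (s : store) (x : nat) (v : tree) : store :=
  fun y => if y == x then v else s y.

Definition head_tree (t : tree) : tree := if t is Node a _ then a else Leaf.
Definition tail_tree (t : tree) : tree := if t is Node _ b then b else Leaf.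

(* In tests, [Leaf] is false and every other tree is true. *)
Definition truth (t : tree) : bool := if t is Leaf then false else true.

Definition enc_bool (b : bool) : tree := if b then Node Leaf Leaf else Leaf.

Fixpoint eval_expr (s : store) (e : expr) : tree :=
  match e with
  | EVar x => s x
  | ENil => Leaf
  | ECons e1 e2 => Node (eval_expr s e1) (eval_expr s e2)
  | EHead e1 => head_tree (eval_expr s e1)
  | ETail e1 => tail_tree (eval_expr s e1)
  end.

(* The commands that remain to be executed, and the current store. *)
Definition config : Type := (seq cmd * store)%type.

Definition halted (c : config) : bool := nilp c.1.

(* As for probabilistic Turing machines, a fresh coin [b] is supplied at each
   step and only [Toss] looks at it.  Evaluating an expression takes one step:
   its size is bounded by a constant depending only on the program. *)
Definition step (c : config) (b : bool) : config :=
  let: (K, s) := c in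
  match K with
  | [::] => c
  | Assign x e :: K' => (K', update s x (eval_expr s e))
  | Toss x :: K' => (K', update s x (enc_bool b))
  | Then c1 c2 :: K' => (c1 :: c2 :: K', s)
  | If e c1 c2 :: K' => ((if truth (eval_expr s e) then c1 else c2) :: K', s)
  | While e c1 :: K' =>
      if truth (eval_expr s e) then (c1 :: While e c1 :: K', s) else (K', s)
  end.

Definition run (c : config) (w : seq bool) : config := foldl step c w.

(* Variable 0 holds the input at the beginning and the output at the end. *)
Definition init (A : cmd) (input : tree) : config :=
  ([:: A], fun x => if x == 0%N then input else Leaf).

Definition output (c : config) : tree := c.2 0%N.

(* On the coin tosses [w], the first halted configuration is the [t]-th. *)
Definition halts_at (c : config) (t : nat) (w : t.-tuple bool) : bool :=
  halted (run c w) && [forall s : 'I_t, ~~ halted (run c (take s w))].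

Definition prob_time (R : realType) (c : config) (t : nat) : R :=
  #|[set w : t.-tuple bool | halts_at c w]|%:R / 2 ^+ t.

(* Expectation of the running time as a random variable with values in
   {0, 1, ..., +oo}: the last term is the contribution of the runs that never
   halt, and it vanishes if they have probability 0 since [+oo * 0 = 0]. *)
Definition expected_time (R : realType) (c : config) : \bar R :=
  (\sum_(0 <= t <oo) (t%:R * prob_time R c t)%:E
   + +oo * (1 - \sum_(0 <= t <oo) (prob_time R c t)%:E))%E.

(** * Input and output format *)

Definition enc_seq (s : seq tree) : tree := foldr Node Leaf s.

(* Unary numerals: the number of variables is polynomially bounded in the
   input size, and so is the size of this encoding in that of any other
   reasonable one. *)
Definition enc_nat (m : nat) : tree := enc_seq (nseq m Leaf).

Definition enc_literal (n : nat) (l : literal n) : tree :=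
  Node (enc_nat l.1) (enc_bool l.2).

Definition enc_clause (n : nat) (C : clause n) : tree :=
  enc_seq [seq enc_literal l | l <- C].

Definition enc_cnf (n : nat) (F : cnf n) : tree :=
  Node (enc_nat n) (enc_seq [seq enc_clause C | C <- F]).

Definition enc_assignment (n : nat) (a : assignment n) : tree :=
  enc_seq [seq enc_bool (a i) | i <- enum 'I_n].

Fixpoint tree_size (t : tree) : nat :=
  if t is Node a b then (tree_size a + tree_size b).+1 else 1%N.

Definition input_size (n : nat) (F : cnf n) : nat := tree_size (enc_cnf F).

(* Every run that halts on input [F] has found a satisfying assignment. *)
Definition finds_solution (A : cmd) (n : nat) (F : cnf n) : Prop :=
  forall w : seq bool, halted (run (init A (enc_cnf F)) w) ->
    exists2 a : assignment n, a \in sat F &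
      output (run (init A (enc_cnf F)) w) = enc_assignment a.

(* Main.v *)
Require Import Defs.
From HB Require Import structures.
From mathcomp Require Import all_boot all_order all_algebra.
From mathcomp Require Import all_classical all_reals all_analysis.
From mathcomp Require Import zify ring lra.
Set Implicit Arguments.
Unset Strict Implicit.
Unset Printing Implicit Defensive.
Import Order.TTheory GRing.Theory Num.Theory.
Import numFieldNormedType.Exports.
Local Open Scope ring_scope.

(** Schoening's random walk, restarted from a uniform assignment until it succeeds.

    Isoperimetry.  Put t = 1/(k-1) and let S be the set of solutions.  Induction
    on n, splitting S along the first coordinate, reduces
      sum_w t^d(w,S) >= ((1+t) / (1 + t^(1/th))^th)^n |S|^th     (0 < th <= 1)
    to a two-point inequality, which is a consequence of the concavity of x^th.
    With p = H^-1(delta) and t^(1/th) = p/(1-p), the right-hand side is at least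
    (1+t)^n (k-1)^(p n), and th <= 1 amounts to p <= 1/k.

    Walk.  A lazy step sets a uniformly chosen literal of a falsified clause to
    true, hence decreases the distance d to a fixed solution with conditional
    probability at least 1/k.  For lam = t (1-eta), the function lam^d grows in
    expectation by a factor at least 1/r = 1 + eta/2^k, so that by induction on T
    a walk of T steps succeeds with probability at least lam^d - r^T.  Taking eta
    of order 1/n keeps lam^d >= t^d / 2, and T of order n^2 makes r^T negligible.

    Running time.  If V bounds the expected cost of a round in which every failure
    is charged V, then V bounds the expected cost of the whole program. *)

(** * Expected running time *)

Lemma sum_tuple0 (V : nmodType) (F : seq bool -> V) :
  \sum_(w : 0.-tuple bool) F w = F [::].
Proof.
by rewrite (big_pred1 [tuple]) // => w; apply/esym/eqP; exact: tuple0.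
Qed.

Lemma sum_tupleS (V : nmodType) (t : nat) (F : seq bool -> V) :
  \sum_(w : t.+1.-tuple bool) F w =
  \sum_(w : t.-tuple bool) F (false :: w) +
  \sum_(w : t.-tuple bool) F (true :: w).
Proof.
rewrite (reindex (fun p : bool * t.-tuple bool => [tuple of p.1 :: p.2])) /=.
  rewrite -(pair_big xpredT xpredT (fun b (w : t.-tuple bool) => F (b :: w))) /=.
  by rewrite big_bool /= addrC.
exists (fun w : t.+1.-tuple bool => (thead w, [tuple of behead w])) => w _ /=.
  by case: w => b w /=; congr pair; apply/val_inj.
by rewrite [RHS]tuple_eta; apply/val_inj.
Qed.

Section ExpectedCost.
Variables (R : realType) (good : pred store) (M : R).

(* Expected number of steps, truncated at [N], plus the penalty [M] for the
   runs that halt within [N - 1] steps in a store which is not [good]: a bound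
   on this quantity which is uniform in [N] and [M] yields at once a bound on
   the expected time and partial correctness. *)
Fixpoint ev (N : nat) (c : config) : R :=
  if N is N'.+1 then
    if halted c then (if good c.2 then 0 else M)
    else 1 + (ev N' (step c false) + ev N' (step c true)) / 2
  else 0.

Lemma evS N c : ev N.+1 c =
  if halted c then (if good c.2 then 0 else M)
  else 1 + (ev N (step c false) + ev N (step c true)) / 2.
Proof. by []. Qed.

Hypothesis M_ge0 : 0 <= M.

Lemma ev_ge0 N c : 0 <= ev N c.
Proof.
elim: N c => [|N IH] c //=; case: ifP => _; first by case: ifP.
by have := IH (step c false); have := IH (step c true); lra.
Qed.

Lemma ev_leS N c : ev N c <= ev N.+1 c.
Proof.
elim: N c => [|N IH] c; first by rewrite ev_ge0.
rewrite /=; case: ifP => // _.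
have := IH (step c false); have := IH (step c true).
rewrite /=; lra.
Qed.

Lemma run_halted c w : halted c -> run c w = c.
Proof.
case: c => -[|//] s _; rewrite /run; by elim: w.
Qed.

(** The coin sequence [w] alone has probability [2 ^- size w] and pays the penalty [M] in full. A
    bound on [ev] that is uniform in [M] therefore excludes bad runs altogether. *)
Lemma ev_bad c w : halted (run c w) -> ~~ good (run c w).2 ->
  M / 2 ^+ size w <= ev (size w).+1 c.
Proof.
elim: w c => [|b w IH] c.
  by rewrite /= => -> /negbTE ->; rewrite expr0 divr1.
have [hc _|hc] := boolP (halted c).
  rewrite run_halted //= hc => /negbTE ->.
  by rewrite ler_pdivrMr ?exprn_gt0// ler_peMr// exprn_ege1// ler1n.
move=> h g; have := IH (step c b) h g; rewrite [ev _ c]evS (negbTE hc).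
have h0 := ev_ge0 (size w).+1 (step c false).
have h1 := ev_ge0 (size w).+1 (step c true).
have -> : M / 2 ^+ size (b :: w) = (M / 2 ^+ size w) / 2.
  by rewrite /= exprS invfM mulrA (mulrAC M).
by case: b h g => _ _ ?; lra.
Qed.

End ExpectedCost.

Lemma halts_atS c (t : nat) b (w : t.-tuple bool) :
  halts_at c [tuple of b :: w] = ~~ halted c && halts_at (step c b) w.
Proof.
rewrite /halts_at andbCA; congr andb.
apply/forallP/andP => [h|[h0 /forallP h] s].
  split; first exact: h ord0.
  by apply/forallP => s; have := h (lift ord0 s).
have [->|[s' ->]] : s = ord0 \/ exists s', s = lift ord0 s'; last exact: h.
  by case: (unliftP ord0 s) => [s' ->|->]; [right; exists s'|left].
exact: h0.
Qed.

Section ProbTime.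
Variable R : realType.
Implicit Type c : config.

Let P := @prob_time R.

Lemma prob_time_sum c t :
  P c t = (\sum_(w : t.-tuple bool) (halts_at c w)%:R) / 2 ^+ t.
Proof.
rewrite /P /prob_time; congr (_ / _).
rewrite -sum1_card natr_sum big_mkcond /=.
by apply: eq_bigr => w _; rewrite inE; case: halts_at.
Qed.

Lemma prob_time_ge0 c t : 0 <= P c t.
Proof. by rewrite /P /prob_time divr_ge0// exprn_ge0. Qed.

Lemma prob_time0 c : P c 0 = (halted c)%:R.
Proof.
rewrite prob_time_sum expr0 divr1 (big_pred1 [tuple]).
  by rewrite /halts_at /=; case: halted => //=; apply: congr1; rewrite (_ : [forall _, _]) //; apply/forallP; case.
by move=> w; apply/esym/eqP; exact: tuple0.
Qed.

Lemma prob_timeS c t : P c t.+1 =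
  if halted c then 0 else (P (step c false) t + P (step c true) t) / 2.
Proof.
(* [sum_tupleS] sums a function of plain lists, whereas [halts_at] takes tuples; [F] restates it as
   a test over [iota]. *)
pose F (w : seq bool) : R :=
  (halted (run c w) && all (fun s => ~~ halted (run c (take s w))) (iota 0 (size w)))%:R.
have FE (m : nat) (w : m.-tuple bool) : (halts_at c w)%:R = F w.
  rewrite /F /halts_at; congr (_ && _)%:R; rewrite size_tuple.
  apply/forallP/allP => [hw i|hw i]; last by apply: hw; rewrite mem_iota /= add0n.
  by rewrite mem_iota /= add0n => im; exact: (hw (Ordinal im)).
have h (b : bool) : \sum_(w : t.-tuple bool) F (b :: w) =
    if halted c then 0 else P (step c b) t * 2 ^+ t :> R.
  rewrite prob_time_sum divfK ?expf_neq0//.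
  rewrite (eq_bigr (fun w : t.-tuple bool =>
    (~~ halted c && halts_at (step c b) w)%:R)); last first.
    by move=> w _; rewrite -halts_atS FE.
  by case: ifP => //= _; rewrite big1.
rewrite prob_time_sum.
under eq_bigr do rewrite FE.
rewrite (sum_tupleS t F).
rewrite (h false) (h true); case: ifP => _; first by rewrite addr0 mul0r.
by rewrite exprS -mulrDl; field; rewrite expf_neq0.
Qed.

Lemma sum_prob_time_le1 c N : \sum_(0 <= t < N) P c t <= 1.
Proof.
elim: N c => [|N IH] c; first by rewrite big_nil.
rewrite big_nat_recl// prob_time0.
under eq_bigr do rewrite prob_timeS.
case: (halted c); first by rewrite big1// addr0.
rewrite -mulr_suml big_split /=.
by have := IH (step c false); have := IH (step c true); lra.
Qed.

(** Without penalty, [ev] is the expectation of min(time, [N]): a run halting at [t < N] contributes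
    [t], every other run [N]. *)
Lemma ev_prob_time good c N :
  ev good 0 N c = \sum_(0 <= t < N) t%:R * P c t +
                  N%:R * (1 - \sum_(0 <= t < N) P c t) :> R.
Proof.
elim: N c => [|N IH] c; first by rewrite /= big_nil mul0r addr0.
rewrite !big_nat_recl// prob_time0 mul0r add0r.
under eq_bigr do rewrite prob_timeS.
under [X in _ - (_ + X)]eq_bigr do rewrite prob_timeS.
rewrite evS; case: (halted c).
  rewrite [X in X + _]big1 => [|i _]; last by rewrite mulr0.
  by rewrite big1// addr0 subrr mulr0 addr0; case: ifP.
rewrite !IH -mulr_suml big_split /=.
under [X in _ = X + _]eq_bigr => i _.
  rewrite (_ : _ * _ = (i%:R * P (step c false) i + i%:R * P (step c true) i +
     (P (step c false) i + P (step c true) i)) / 2); last by rewrite -natr1; field.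
  over.
rewrite -mulr_suml !big_split /= -natr1.
set a := \sum_(_ <= _ < _) _; set b := \sum_(_ <= _ < _) _.
set a' := \sum_(_ <= _ < _) _; set b' := \sum_(_ <= _ < _) _.
by field.
Qed.

(** The partial sums of the first series lie below [ev]. For the [+oo] term Markov's inequality
    applies: runs still active after [N] steps contribute [N] each, so their mass is at most
    [V / N], and the halting probabilities sum to at least 1. *)
Lemma expected_time_le good c (V : R) :
  (forall N, ev good 0 N c <= V) -> (expected_time R c <= V%:E)%E.
Proof.
move=> hV.
have P0 t : (0 <= t)%N -> true -> (0 <= (P c t)%:E)%E.
  by move=> _ _; rewrite lee_fin prob_time_ge0.
have tP0 t : (0 <= t)%N -> true -> (0 <= (t%:R * P c t)%:E)%E.
  by move=> _ _; rewrite lee_fin mulr_ge0// prob_time_ge0.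
have V0 : 0 <= V by have := hV 0%N.
have h1 : (\sum_(0 <= t <oo) (t%:R * P c t)%:E <= V%:E)%E.
  apply: lime_le; first exact: is_cvg_nneseries.
  apply: nearW => N; rewrite sumEFin lee_fin.
  apply: le_trans (hV N); rewrite ev_prob_time lerDl mulr_ge0// subr_ge0.
  exact: sum_prob_time_le1.
have h2 : (1 <= \sum_(0 <= t <oo) (P c t)%:E)%E.
  apply/lee_addgt0Pr => e e0.
  pose N := (Num.truncn (V / e)).+1.
  have N0 : 0 < N%:R :> R by rewrite ltr0n.
  have VN : V / N%:R <= e.
    rewrite ler_pdivrMr// mulrC -ler_pdivrMr// ltW//.
    by rewrite /N; apply: truncnS_gt.
  have : (\sum_(0 <= t < N) (P c t)%:E <= \sum_(0 <= t <oo) (P c t)%:E)%E.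
    exact: nneseries_lim_ge.
  rewrite sumEFin => hs.
  apply: (@le_trans _ _ ((\sum_(0 <= t < N) P c t)%:E + e%:E)%E); last exact: leeD.
  rewrite -EFinD lee_fin; apply: le_trans (lerD (lexx _) VN).
  have := hV N; rewrite ev_prob_time => h.
  have s0 : 0 <= \sum_(0 <= t < N) t%:R * P c t.
    by apply: sumr_ge0 => t _; rewrite mulr_ge0// prob_time_ge0.
  rewrite -lerBlDl ler_pdivlMr// mulrC.
  by apply: le_trans h; rewrite lerDr.
rewrite /expected_time -/P -[leRHS]adde0; apply: leeD => //.
apply: mule_ge0_le0 => //.
by rewrite sube_le0.
Qed.

End ProbTime.

(** * The program and its simulation *)

Local Notation vA := 0%N.
Local Notation vF := 1%N.
Local Notation vN := 2%N.
Local Notation vZ0 := 3%N.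
Local Notation vZ := 4%N.
Local Notation vGo := 5%N.
Local Notation vFC := 6%N.
Local Notation vC := 7%N.
Local Notation vBad := 8%N.
Local Notation vOk := 9%N.
Local Notation vP := 10%N.
Local Notation vQ := 11%N.
Local Notation vR := 12%N.
Local Notation vSel := 13%N.

Local Notation "c1 ;; c2" := (Then c1 c2) (at level 61, right associativity).
Local Notation "x ::= e" := (Assign x e) (at level 60).
Local Notation "$ x" := (EVar x) (at level 5).
Local Notation ENode := (ECons ENil ENil).

(** The language has no empty command; a self-assignment stands for it. *)
Definition skip : cmd := vA ::= $vA.

Definition lookup : cmd :=
  While $vQ (vP ::= ETail $vP ;; vQ ::= ETail $vQ).

Definition check_clause : cmd :=
  While $vC
    (vP ::= $vA ;; vQ ::= EHead (EHead $vC) ;; lookup ;;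
     If (EHead $vP) (If (ETail (EHead $vC)) (vOk ::= ENode) skip)
                    (If (ETail (EHead $vC)) skip (vOk ::= ENode)) ;;
     vP ::= ENil ;; vC ::= ETail $vC).

(* Leaves in [vBad] a clause falsified by the assignment [vA], if any. *)
Definition check_cnf : cmd :=
  vFC ::= $vF ;;
  While $vFC
    (vC ::= EHead $vFC ;; check_clause ;;
     If $vOk skip (vBad ::= EHead $vFC) ;;
     vOk ::= ENil ;; vFC ::= ETail $vFC).

(* One coin is tossed for each literal of the clause [vC].  The literal chosen
   is [vSel] if exactly one coin shows heads; [vOk] records a second head. *)
Definition select : cmd :=
  While $vC
    (Toss vR ;;
     If $vR (If $vSel (vOk ::= ENode) (vSel ::= EHead $vC)) skip ;;
     vR ::= ENil ;; vC ::= ETail $vC).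

Definition push : cmd :=
  While $vQ (vR ::= ECons (EHead $vP) $vR ;; vP ::= ETail $vP ;; vQ ::= ETail $vQ).

Definition pop : cmd :=
  While $vR (vP ::= ECons (EHead $vR) $vP ;; vR ::= ETail $vR).

(** A list can only be changed at its head: the prefix before the position is reversed onto [vR],
    the head is replaced, and the prefix is moved back. *)
Definition set_literal : cmd :=
  vP ::= $vA ;; vQ ::= EHead $vSel ;; push ;;
  vP ::= ECons (ETail $vSel) (ETail $vP) ;; pop ;;
  vA ::= $vP ;; vP ::= ENil.

Definition walk_step : cmd :=
  check_cnf ;;
  If $vBad
    (vC ::= $vBad ;; select ;;
     If $vOk skip (If $vSel set_literal skip) ;;
     vOk ::= ENil ;; vSel ::= ENil ;; vBad ::= ENil ;; vZ ::= ETail $vZ)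
    (vZ ::= ENil ;; vGo ::= ENil).

Definition sample : cmd :=
  While $vP (Toss vR ;; vA ::= ECons $vR $vA ;; vP ::= ETail $vP).

Definition restart : cmd :=
  While $vGo
    (vA ::= ENil ;; vP ::= $vN ;; sample ;; vR ::= ENil ;; vZ ::= $vZ0 ;;
     While $vZ walk_step).

Definition push_const (C : nat) (e : expr) : expr := iter C (ECons ENil) e.

Definition count_row (C : nat) : cmd :=
  While $vQ (vZ0 ::= push_const C $vZ0 ;; vQ ::= ETail $vQ).

(** Unary multiplication by nested loops: each cell of [vP] adds a row of [C * n.+1] cells to the
    step counter. *)
Definition count_loop (C : nat) : cmd :=
  While $vP (vQ ::= ECons ENil $vN ;; count_row C ;; vP ::= ETail $vP).

(* Each walk makes at most [C * n.+1 ^ 2] steps, the length of [vZ0]. *)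
Definition schoening (C : nat) : cmd :=
  vF ::= ETail $vA ;; vN ::= EHead $vA ;;
  vP ::= ECons ENil $vN ;; count_loop C ;; vGo ::= ENode ;; restart.

(** Stores are kept as explicit lists of the program variables, so that symbolic execution computes
    by [simpl]. *)
Definition mk (l : seq tree) : store := fun y => nth Leaf l y.
Arguments mk l y /.

Lemma update_mk l x v : update (mk l) x v = mk (set_nth Leaf l x v).
Proof. by apply/funext => y; rewrite /update /= nth_set_nth. Qed.

Definition enc_bits (a : seq bool) : tree := enc_seq [seq enc_bool b | b <- a].

Lemma truth_enc_bool b : truth (enc_bool b) = b.
Proof. by case: b. Qed.

Lemma head_enc_bits a : head_tree (enc_bits a) = enc_bool (head false a).
Proof. by case: a. Qed.

Lemma tail_enc_bits a : tail_tree (enc_bits a) = enc_bits (behead a).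
Proof. by case: a. Qed.

Lemma iter_tail_enc_bits i a : iter i tail_tree (enc_bits a) = enc_bits (drop i a).
Proof.
elim: i => [|i IH]; first by rewrite drop0.
by rewrite iterS IH tail_enc_bits -drop1 drop_drop add1n.
Qed.

Lemma head_drop (T : Type) (x : T) i s : head x (drop i s) = nth x s i.
Proof. by rewrite -nth0 nth_drop addn0. Qed.

(** The default [false] mirrors [head_tree Leaf = Leaf], so that these functions agree with the
    program on bit lists of any length. *)
Definition lit_sat n (a : seq bool) (l : literal n) : bool :=
  nth false a l.1 == l.2.
Definition clause_sat n (a : seq bool) (c : clause n) : bool :=
  has (lit_sat a) c.
Definition cnf_sat n (a : seq bool) (F : cnf n) : bool := all (clause_sat a) F.
Definition set_lit n (a : seq bool) (l : literal n) : seq bool :=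
  set_nth false a l.1 l.2.

Definition hamming (m : nat) (a b : seq bool) : nat :=
  \sum_(i < m) (nth false a i != nth false b i).

Lemma hamming_set m a b (i : 'I_m) x :
  hamming m (set_nth false a i x) b =
  ((x != nth false b i) + \sum_(j < m | j != i) (nth false a j != nth false b j))%N.
Proof.
rewrite /hamming (bigD1 i)//= nth_set_nth /= eqxx; congr addn.
apply: eq_bigr => j ji; rewrite nth_set_nth /=.
by have /negbTE -> : val j != val i by [].
Qed.

Lemma hamming_set_le m a b (i : 'I_m) x :
  (hamming m (set_nth false a i x) b <= (hamming m a b).+1)%N.
Proof.
rewrite hamming_set {1}/hamming [X in (_ <= X.+1)%N](bigD1 i)//=.
by rewrite -addSn leq_add2r; case: (x != _).
Qed.

Lemma hamming_set_eq m a b (i : 'I_m) x :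
  nth false a i != x -> x = nth false b i ->
  hamming m a b = (hamming m (set_nth false a i x) b).+1.
Proof.
move=> ax xb; rewrite hamming_set xb eqxx add0n {1}/hamming (bigD1 i)//=.
by rewrite -xb ax.
Qed.

(** * Symbolic execution with step counts *)

Section Simulation.
Variables (R : realType) (good : pred store) (M : R).
Hypothesis M_ge0 : 0 <= M.

Let E N c := @ev R good M N c.

(** The truncation [N] is the same on both sides, which monotonicity in [N] ([ev_leS]) permits;
    bounds then compose without tracking the horizon. *)
Definition reach (j : nat) (c c' : config) : Prop :=
  forall N, E N c <= j%:R + E N c'.

Lemma reach_refl c : reach 0 c c.
Proof. by move=> N; rewrite add0r. Qed.

Lemma reach_trans j1 j2 c1 c2 c3 :
  reach j1 c1 c2 -> reach j2 c2 c3 -> reach (j1 + j2) c1 c3.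
Proof.
move=> h1 h2 N; apply: le_trans (h1 N) _.
by rewrite natrD -addrA lerD2l.
Qed.

Lemma reach_le j j' c c' : reach j c c' -> (j <= j')%N -> reach j' c c'.
Proof.
by move=> h jj N; apply: le_trans (h N) _; rewrite lerD2r ler_nat.
Qed.

Lemma reach_ev j c c' N v :
  reach j c c' -> E N c' <= v -> E N c <= j%:R + v.
Proof. by move=> h hv; apply: le_trans (h N) _; rewrite lerD2l. Qed.

Lemma ev_step c N : ~~ halted c ->
  E N c <= 1 + (E N (step c false) + E N (step c true)) / 2.
Proof.
move=> hc; apply: le_trans (ev_leS good M_ge0 N c) _.
by rewrite evS (negbTE hc).
Qed.

Lemma reach_step j c c' d : ~~ halted c -> (forall b, step c b = d) ->
  reach j d c' -> reach j.+1 c c'.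
Proof.
move=> hc hd h N; apply: le_trans (ev_step _ hc) _.
by rewrite !hd; have := h N; rewrite -[j.+1%:R]natr1; lra.
Qed.

Lemma reach_assign x e K l j c' :
  reach j (K, mk (set_nth Leaf l x (eval_expr (mk l) e))) c' ->
  reach j.+1 (Assign x e :: K, mk l) c'.
Proof. by apply: reach_step => // b; rewrite /= update_mk. Qed.

Lemma reach_then c1 c2 K s j c' :
  reach j (c1 :: c2 :: K, s) c' -> reach j.+1 (Then c1 c2 :: K, s) c'.
Proof. exact: reach_step. Qed.

Lemma reach_if e c1 c2 K s j c' :
  reach j ((if truth (eval_expr s e) then c1 else c2) :: K, s) c' ->
  reach j.+1 (If e c1 c2 :: K, s) c'.
Proof. exact: reach_step. Qed.

Lemma reach_while e c1 K s j c' :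
  reach j (if truth (eval_expr s e) then (c1 :: While e c1 :: K, s) else (K, s)) c' ->
  reach j.+1 (While e c1 :: K, s) c'.
Proof. exact: reach_step. Qed.

Lemma ev_toss x K l N v0 v1 :
  E N (K, mk (set_nth Leaf l x Leaf)) <= v0 ->
  E N (K, mk (set_nth Leaf l x (Node Leaf Leaf))) <= v1 ->
  E N (Toss x :: K, mk l) <= 1 + (v0 + v1) / 2.
Proof.
move=> h0 h1; apply: le_trans (ev_step _ _) _ => //=.
by rewrite !update_mk /=; lra.
Qed.

(** The step count is an existential variable filled in by unification; [reach_le] afterwards
    compares it with the announced bound. Loops are unfolded only on demand, by [runw]. *)
Ltac run1 :=
  first [ eapply reach_assign | eapply reach_then | eapply reach_if ]; simpl.
Ltac runw := eapply reach_while; simpl.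

Lemma reach_lookup K a f n z0 z go fc c bad ok p i r sel :
  reach (4 * i + 1)
    (lookup :: K, mk [:: a; f; n; z0; z; go; fc; c; bad; ok; p; enc_nat i; r; sel])
    (K, mk [:: a; f; n; z0; z; go; fc; c; bad; ok; iter i tail_tree p; Leaf; r; sel]).
Proof.
elim: i p => [|i IH] p.
  by runw; apply: reach_refl.
eapply reach_le.
  runw; do 3 run1; rewrite -iterS iterSr; exact: IH.
lia.
Qed.

Lemma reach_check_clause m K (a : seq bool) f n z0 z go fc (cl : clause m) bad o r sel :
  reach ((4 * m + 24) * size cl + 1)
    (check_clause :: K, mk [:: enc_bits a; f; n; z0; z; go; fc; enc_clause cl;
       bad; enc_bool o; Leaf; Leaf; r; sel])
    (K, mk [:: enc_bits a; f; n; z0; z; go; fc; Leaf;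
       bad; enc_bool (o || clause_sat a cl); Leaf; Leaf; r; sel]).
Proof.
elim: cl o => [|l cl IH] o.
  rewrite orbF; eapply reach_le; first by runw; apply: reach_refl.
  lia.
eapply reach_le.
  runw; do 5 run1.
  eapply reach_trans; first exact: reach_lookup.
  rewrite iter_tail_enc_bits; do 2 run1.
  rewrite head_enc_bits head_drop truth_enc_bool.
  have -> : o || clause_sat a (l :: cl) = (o || lit_sat a l) || clause_sat a cl.
    by rewrite orbA.
  rewrite /lit_sat; case: (nth _ _ _); run1; case: (l.2); do 4 run1;
    rewrite ?orbT ?orbF; apply: IH || exact: (IH true).
have := ltn_ord l.1; rewrite /=; nia.
Qed.

Definition last_falsified m (a : seq bool) (bad : tree) (F : cnf m) : tree :=
  foldl (fun b c => if clause_sat a c then b else enc_clause c) bad F.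

Lemma last_falsifiedP m a bad (F : cnf m) :
  if cnf_sat a F then last_falsified a bad F = bad
  else exists c, [/\ c \in F, ~~ clause_sat a c & last_falsified a bad F = enc_clause c].
Proof.
elim: F bad => //= c F IH bad.
have [hc|hc] /= := boolP (clause_sat a c).
  have := IH bad; case: ifP => // _ [c' [h1 h2 h3]].
  by exists c'; rewrite in_cons h1 orbT.
have := IH (enc_clause c); case: ifP => [_ h|_ [c' [h1 h2 h3]]].
  by exists c; rewrite in_cons eqxx.
by exists c'; rewrite in_cons h1 orbT.
Qed.

Lemma reach_check_cnf m K (a : seq bool) n z0 z go fc (F : cnf m) bad r sel L :
  (forall c, c \in F -> size c <= L)%N ->
  reach (((4 * m + 24) * L + 12) * size F + 3)
    (check_cnf :: K, mk [:: enc_bits a; enc_seq [seq enc_clause c | c <- F]; n;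
       z0; z; go; fc; Leaf; bad; Leaf; Leaf; Leaf; r; sel])
    (K, mk [:: enc_bits a; enc_seq [seq enc_clause c | c <- F]; n;
       z0; z; go; Leaf; Leaf; last_falsified a bad F; Leaf; Leaf; Leaf; r; sel]).
Proof.
move=> hL; set f := enc_seq _.
suff h (G : cnf m) bad' : (forall c, c \in G -> size c <= L)%N ->
  reach (((4 * m + 24) * L + 12) * size G + 1)
    (While $vFC
    (vC ::= EHead $vFC ;; check_clause ;;
     If $vOk skip (vBad ::= EHead $vFC) ;;
     vOk ::= ENil ;; vFC ::= ETail $vFC) :: K, mk [:: enc_bits a; f; n;
       z0; z; go; enc_seq [seq enc_clause c | c <- G]; Leaf; bad'; Leaf; Leaf; Leaf; r; sel])
    (K, mk [:: enc_bits a; f; n;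
       z0; z; go; Leaf; Leaf; last_falsified a bad' G; Leaf; Leaf; Leaf; r; sel]).
  by eapply reach_le; [do 2 run1; exact: h|lia].
elim: G bad' => [|c G IH] bad' hG.
  by eapply reach_le; [runw; apply: reach_refl|lia].
eapply reach_le.
  runw; do 3 run1.
  eapply reach_trans; first by apply: (@reach_check_clause m _ a _ _ _ _ _ _ c _ false).
  rewrite orFb; do 2 run1; rewrite truth_enc_bool.
  case: (clause_sat a c); do 4 run1; apply: IH => c' hc'; apply: hG; rewrite in_cons hc' orbT//.
have hs : (size c <= L)%N := hG c (mem_head _ _).
have := leq_mul (leqnn (4 * m + 24)) hs.
rewrite [size (_ :: _)]/= mulnS; lia.
Qed.

Lemma reach_push K a f n z0 z go fc c bad ok (p s : seq bool) i sel :
  reach (6 * i + 1)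
    (push :: K, mk [:: a; f; n; z0; z; go; fc; c; bad; ok; enc_bits p; enc_nat i;
       enc_bits s; sel])
    (K, mk [:: a; f; n; z0; z; go; fc; c; bad; ok; enc_bits (drop i p); Leaf;
       enc_bits (catrev (mkseq (nth false p) i) s); sel]).
Proof.
elim: i p s => [|i IH] p s.
  by rewrite drop0; runw; apply: reach_refl.
have -> : drop i.+1 p = drop i (behead p) by rewrite -drop1 drop_drop addn1.
have -> : catrev (mkseq (nth false p) i.+1) s =
          catrev (mkseq (nth false (behead p)) i) (head false p :: s).
  rewrite -nth0 /mkseq /= (iotaDl 1 0) -map_comp /=; congr catrev.
  by apply: eq_map => j; rewrite /= nth_behead.
eapply reach_le.
  runw; do 5 run1; rewrite head_enc_bits tail_enc_bits; exact: (IH _ (_ :: _)).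
lia.
Qed.

Lemma reach_pop K a f n z0 z go fc c bad ok (p s : seq bool) q sel :
  reach (4 * size s + 1)
    (pop :: K, mk [:: a; f; n; z0; z; go; fc; c; bad; ok; enc_bits p; q;
       enc_bits s; sel])
    (K, mk [:: a; f; n; z0; z; go; fc; c; bad; ok; enc_bits (catrev s p); q;
       Leaf; sel]).
Proof.
elim: s p => [|b s IH] p.
  by runw; apply: reach_refl.
eapply reach_le.
  runw; do 3 run1; exact: (IH (b :: p)).
rewrite /=; lia.
Qed.

Lemma set_nthE_drop (T : Type) (x : T) (s : seq T) i y :
  set_nth x s i y = mkseq (nth x s) i ++ y :: behead (drop i s).
Proof.
elim: i s => [|i IH] s; first by rewrite drop0; case: s.
have -> : set_nth x s i.+1 y = head x s :: set_nth x (behead s) i y.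
  by case: s => //=; rewrite set_nth_nil.
rewrite IH -drop1 drop_drop addn1 /mkseq /= (iotaDl 1 0) -map_comp nth0.
by congr (_ :: _ ++ _); apply: eq_map => j; rewrite /= nth_drop.
Qed.

Lemma reach_set_literal m K (a : seq bool) f n z0 z go fc c bad ok (l : literal m) :
  reach (10 * m + 14)
    (set_literal :: K, mk [:: enc_bits a; f; n; z0; z; go; fc; c; bad; ok; Leaf; Leaf;
       Leaf; enc_literal l])
    (K, mk [:: enc_bits (set_lit a l); f; n; z0; z; go; fc; c; bad; ok; Leaf; Leaf;
       Leaf; enc_literal l]).
Proof.
eapply reach_le.
  do 5 run1.
  eapply reach_trans; first exact: (@reach_push _ _ _ _ _ _ _ _ _ _ _ a [::]).
  do 3 run1; rewrite tail_enc_bits.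
  eapply reach_trans.
    exact: (@reach_pop _ _ _ _ _ _ _ _ _ _ _ (l.2 :: behead (drop l.1 a))).
  do 3 run1.
  have hs : set_lit a l = catrev (catrev (mkseq (nth false a) l.1) [::])
                                 (l.2 :: behead (drop l.1 a)).
    by rewrite /set_lit set_nthE_drop catrevE -/(rev _) revK.
  rewrite hs.
  exact: reach_refl.
rewrite -/(rev _) size_rev size_mkseq; have := ltn_ord l.1; lia.
Qed.

Lemma reach_ev_le j c c' N v v' :
  reach j c c' -> E N c' <= v -> j%:R + v <= v' -> E N c <= v'.
Proof. by move=> h hv; apply: le_trans; exact: reach_ev h hv. Qed.

(** * Choice of a literal by fair coins *)

Section Select.
Variables (m : nat) (K : seq cmd) (a f n z0 z go fc bad : tree) (N : nat) (vd : R).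
Let st c ok sel :=
  mk [:: a; f; n; z0; z; go; fc; c; bad; ok; Leaf; Leaf; Leaf; sel].
Implicit Types (cl : clause m) (l : literal m).

Hypothesis dead_le : forall l, E N (K, st Leaf (Node Leaf Leaf) (enc_literal l)) <= vd.

Lemma ev_select_dead cl l :
  E N (select :: K, st (enc_clause cl) (Node Leaf Leaf) (enc_literal l)) <=
    (10 * size cl + 1)%:R + vd.
Proof.
elim: cl => [|l' cl IH].
  by apply: reach_ev_le (dead_le l) _; [runw; exact: reach_refl|].
eapply (@reach_ev_le 2); first by runw; run1; exact: reach_refl.
  apply: ev_toss.
    apply: (@reach_ev 7); last exact: IH.
    by eapply reach_le; [simpl; do 6 run1; exact: reach_refl|].
  apply: (@reach_ev 7); last exact: IH.
  by eapply reach_le; [simpl; do 7 run1; exact: reach_refl|].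
rewrite [size (_ :: _)]/= !natrD !natrM -[(size cl).+1%:R]natr1; lra.
Qed.

Variable v : literal m -> R.
Hypothesis one_le : forall l, E N (K, st Leaf Leaf (enc_literal l)) <= v l.

(** One head has been seen: [l] remains selected exactly when all remaining coins show tails. *)
Lemma ev_select_one cl l :
  E N (select :: K, st (enc_clause cl) Leaf (enc_literal l)) <=
    (10 * size cl + 1)%:R + (2^-1 ^+ size cl * v l + (1 - 2^-1 ^+ size cl) * vd).
Proof.
elim: cl => [|l' cl IH].
  apply: reach_ev_le (one_le l) _; first by runw; exact: reach_refl.
  by rewrite expr0 mul1r subrr mul0r addr0.
eapply (@reach_ev_le 2); first by runw; run1; exact: reach_refl.
  apply: ev_toss.
    apply: (@reach_ev 7); last exact: IH.
    by eapply reach_le; [simpl; do 6 run1; exact: reach_refl|].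
  apply: (@reach_ev 7); last exact: (@ev_select_dead cl l).
  by eapply reach_le; [simpl; do 7 run1; exact: reach_refl|].
rewrite [size (_ :: _)]/= !natrD !natrM -[(size cl).+1%:R]natr1 exprS; lra.
Qed.

Hypothesis none_le : E N (K, st Leaf Leaf Leaf) <= vd.

(** With s the size of [cl], a given literal is selected with probability 2^-s: its own coin shows
    heads and all others tails. Conditionally on a selection the choice is thus uniform, although a
    bounded number of fair coins cannot choose uniformly among s literals in general; otherwise the
    step is idle, with value [vd]. *)
Lemma ev_select cl :
  E N (select :: K, st (enc_clause cl) Leaf Leaf) <=
    (10 * size cl + 1)%:R + (2^-1 ^+ size cl * (\sum_(l <- cl) v l) +
                             (1 - (size cl)%:R * 2^-1 ^+ size cl) * vd).
Proof.
elim: cl => [|l cl IH].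
  apply: reach_ev_le none_le _; first by runw; exact: reach_refl.
  by rewrite big_nil mulr0 add0r mul0r subr0 mul1r.
eapply (@reach_ev_le 2); first by runw; run1; exact: reach_refl.
  apply: ev_toss.
    apply: (@reach_ev 7); last exact: IH.
    by eapply reach_le; [simpl; do 6 run1; exact: reach_refl|].
  apply: (@reach_ev 7); last exact: (@ev_select_one cl l).
  by eapply reach_le; [simpl; do 7 run1; exact: reach_refl|].
rewrite [size (_ :: _)]/= !natrD !natrM -[(size cl).+1%:R]natr1 exprS big_cons.
lra.
Qed.

End Select.

(** * One step of the walk *)

Section WalkStep.
Variables (m : nat) (F : cnf m) (L : nat) (n z0 : tree).
Hypothesis size_le : forall c, c \in F -> (size c <= L)%N.

Definition step_cost : nat :=
  (((4 * m + 24) * L + 12) * size F + 10 * L + 10 * m + 40)%N.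

Let st a z go := mk [:: enc_bits a; enc_seq [seq enc_clause c | c <- F]; n; z0; z; go;
  Leaf; Leaf; Leaf; Leaf; Leaf; Leaf; Leaf; Leaf].

Lemma ev_walk_step_sat K a z N v : cnf_sat a F ->
  E N (K, st a Leaf Leaf) <= v ->
  E N (walk_step :: K, st a z (Node Leaf Leaf)) <= step_cost%:R + v.
Proof.
move=> ha hv; apply: reach_ev hv.
have := last_falsifiedP a Leaf F; rewrite ha => hl.
eapply reach_le.
  run1; eapply reach_trans; first exact: (@reach_check_cnf m _ a _ _ _ _ _ F _ _ _ L size_le).
  by rewrite hl; do 4 run1; exact: reach_refl.
rewrite /step_cost; lia.
Qed.

(** The clause is produced before its nonemptiness is assumed: an empty clause is encoded by [Leaf],
    which the test on [vBad] would take for the absence of a falsified clause. The caller derives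
    nonemptiness from the existence of a solution. *)
Lemma ev_walk_step_unsat K a t z N (v : seq bool -> R) : ~~ cnf_sat a F ->
  (forall b, E N (K, st b z (Node Leaf Leaf)) <= v b) ->
  exists c : clause m, [/\ c \in F, ~~ clause_sat a c &
    (0 < size c)%N -> E N (walk_step :: K, st a (Node t z) (Node Leaf Leaf)) <= step_cost%:R +
      (2^-1 ^+ size c * (\sum_(l <- c) v (set_lit a l)) +
       (1 - (size c)%:R * 2^-1 ^+ size c) * v a)].
Proof.
move=> ha hv.
have := last_falsifiedP a Leaf F; rewrite (negbTE ha) => -[c [cF ca hl]].
exists c; split => // c0.
have cL : (size c <= L)%N := size_le cF.
(* Common bound on the steps that follow the selection, whatever its outcome. The outcome weights
   sum to 1, so [w] is paid once. *)
pose w : R := (10 * m + 25)%:R.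
set K' := [:: If (EVar vOk) skip (If (EVar vSel) set_literal skip) ;;
     vOk ::= ENil ;; vSel ::= ENil ;; vBad ::= ENil ;; vZ ::= ETail (EVar vZ)] ++ K.
apply: (@reach_ev_le (((4 * m + 24) * L + 12) * size F + 8) _
  (select :: K', mk [:: enc_bits a; enc_seq [seq enc_clause c | c <- F]; n;
     z0; Node t z; Node Leaf Leaf; Leaf; enc_clause c; enc_clause c; Leaf; Leaf; Leaf; Leaf; Leaf])).
- eapply reach_le.
    run1; eapply reach_trans; first exact: (@reach_check_cnf m _ a _ _ _ _ _ F _ _ _ L size_le).
    rewrite hl; run1.
    have -> : truth (enc_clause c) by case: (c) c0.
    by do 3 run1; exact: reach_refl.
  lia.
- apply: (@ev_select m _ _ _ _ _ _ _ _ _ _ (w + v a) _ (fun l => w + v (set_lit a l))).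
  + move=> l; apply: reach_ev (hv a); eapply reach_le.
      by do 10 run1; exact: reach_refl.
    lia.
  + move=> l; apply: reach_ev (hv (set_lit a l)); eapply reach_le.
      do 3 run1; eapply reach_trans; first exact: reach_set_literal.
      by do 7 run1; exact: reach_refl.
    lia.
  + apply: reach_ev (hv a); eapply reach_le.
      by do 11 run1; exact: reach_refl.
    lia.
- have -> : \sum_(l <- c) (w + v (set_lit a l)) =
            (size c)%:R * w + \sum_(l <- c) v (set_lit a l).
    by rewrite big_split /= big_const_seq count_predT iter_addr_0 mulr_natl.
  set A := (((4 * m + 24) * L + 12) * size F + 8)%N.
  set q := 2^-1 ^+ _; set S := \sum_(_ <- _) _.
  have : (A + (10 * size c + 1) + (10 * m + 25) <= step_cost)%N.
    by rewrite /A /step_cost; lia.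
  rewrite -(ler_nat R) !(natrD _ (A + _)%N) (natrD _ A) -/w => hc.
  rewrite -subr_ge0; move: hc; rewrite -subr_ge0.
  by congr (0 <= _); ring.
Qed.

End WalkStep.

(** Bits are pushed in front of the accumulator, so the tossed word [w] ends up reversed, hence
    [catrev]. *)
Lemma ev_sample K f n z0 z go N m (g : seq bool -> R) :
  (forall a r, size a = m -> E N (K, mk [:: enc_bits a; f; n; z0; z; go;
     Leaf; Leaf; Leaf; Leaf; Leaf; Leaf; r; Leaf]) <= g a) ->
  forall j acc r, (size acc + j)%N = m ->
  E N (sample :: K, mk [:: enc_bits acc; f; n; z0; z; go;
     Leaf; Leaf; Leaf; Leaf; enc_nat j; Leaf; r; Leaf]) <=
  (6 * j + 1)%:R + (\sum_(w : j.-tuple bool) g (catrev w acc)) / 2 ^+ j.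
Proof.
move=> hg; elim=> [|j IH] acc r.
  rewrite addn0 => /hg h.
  rewrite expr0 divr1 (@sum_tuple0 _ (fun w => g (catrev w acc))).
  by apply: (@reach_ev_le 1 _ _ _ _ _ _ (h r)); first by runw; exact: reach_refl.
rewrite addnS -addSn => hj.
eapply (@reach_ev_le 2); first by runw; run1; exact: reach_refl.
  apply: ev_toss.
    apply: (@reach_ev 3); last exact: (IH (false :: acc) Leaf hj).
    by simpl; do 3 run1; exact: reach_refl.
  apply: (@reach_ev 3); last exact: (IH (true :: acc) (Node Leaf Leaf) hj).
  by simpl; do 3 run1; exact: reach_refl.
rewrite (@sum_tupleS _ _ (fun w => g (catrev w acc))) /=.
set S0 := \sum_(_ : _) _; set S1 := \sum_(_ : _) _.
rewrite mulnS -addnA natrD exprS invfM.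
have -> : (S0 + S1) * (2^-1 * (2 ^+ j)^-1) = (S0 / 2 ^+ j + S1 / 2 ^+ j) / 2 by ring.
lra.
Qed.

Lemma eval_push_const s C e :
  eval_expr s (push_const C e) = iter C (Node Leaf) (eval_expr s e).
Proof. by rewrite /push_const; elim: C => //= C ->. Qed.

Lemma iter_Node_enc_nat C x : iter C (Node Leaf) (enc_nat x) = enc_nat (C + x).
Proof. by elim: C => //= C ->. Qed.

Lemma reach_count_row C K a f n x z go fc c bad ok p j r sel :
  reach (4 * j + 1)
    (count_row C :: K, mk [:: a; f; n; enc_nat x; z; go; fc; c; bad; ok; p; enc_nat j; r; sel])
    (K, mk [:: a; f; n; enc_nat (C * j + x); z; go; fc; c; bad; ok; p; Leaf; r; sel]).
Proof.
elim: j x => [|j IH] x.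
  by rewrite !muln0; runw; exact: reach_refl.
have -> : (C * j.+1 + x = C * j + (C + x))%N by rewrite mulnS addnCA addnA.
eapply reach_le.
  runw; do 3 run1; rewrite eval_push_const /= iter_Node_enc_nat; exact: IH.
lia.
Qed.

Lemma reach_count_loop C K a f m x z go fc c bad ok i r sel :
  reach ((4 * m + 11) * i + 1)
    (count_loop C :: K, mk [:: a; f; enc_nat m; enc_nat x; z; go; fc; c; bad; ok;
       enc_nat i; Leaf; r; sel])
    (K, mk [:: a; f; enc_nat m; enc_nat (C * m.+1 * i + x); z; go; fc; c; bad; ok;
       Leaf; Leaf; r; sel]).
Proof.
elim: i x => [|i IH] x.
  by rewrite !muln0; runw; exact: reach_refl.
have -> : (C * m.+1 * i.+1 + x = C * m.+1 * i + (C * m.+1 + x))%N.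
  by rewrite mulnS addnCA addnA.
eapply reach_le.
  runw; do 3 run1.
  eapply reach_trans; first by apply: (@reach_count_row C _ _ _ _ _ _ _ _ _ _ _ _ m.+1).
  run1; exact: IH.
lia.
Qed.

Lemma init_mk A t :
  init A t = ([:: A], mk [:: t; Leaf; Leaf; Leaf; Leaf; Leaf; Leaf; Leaf; Leaf;
                             Leaf; Leaf; Leaf; Leaf; Leaf]).
Proof. by congr pair; apply/funext; do 15 case=> //. Qed.

Definition setup_cost (m : nat) : nat := ((4 * m + 11) * m.+1 + 10)%N.

Lemma reach_setup C m (F : cnf m) :
  reach (setup_cost m) (init (schoening C) (enc_cnf F))
    ([:: restart], mk [:: enc_cnf F; enc_seq [seq enc_clause c | c <- F]; enc_nat m;
       enc_nat (C * m.+1 * m.+1); Leaf; Node Leaf Leaf;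
       Leaf; Leaf; Leaf; Leaf; Leaf; Leaf; Leaf; Leaf]).
Proof.
rewrite init_mk; eapply reach_le.
  do 7 run1.
  eapply reach_trans; first by apply: (@reach_count_loop C _ _ _ m 0 _ _ _ _ _ _ m.+1).
  by rewrite addn0; do 2 run1; exact: reach_refl.
rewrite /setup_cost; lia.
Qed.

(** * Success probability of a walk *)

Section WalkAnalysis.
Variables (m k : nat) (F : cnf m) (L : nat) (b : seq bool) (lam eta V : R).
Hypothesis size_le_k : forall c, c \in F -> (size c <= k)%N.
Hypothesis size_le_L : forall c, c \in F -> (size c <= L)%N.
Hypothesis b_sat : cnf_sat b F.
Hypothesis lam_gt0 : 0 < lam.
Hypothesis lam_le : lam <= 2^-1.
Hypothesis eta_ge0 : 0 <= eta.
Hypothesis lamE : (k%:R - 1) * lam = 1 - eta.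
Hypothesis V_ge0 : 0 <= V.

Let r : R := (1 + 2^-1 ^+ k * eta)^-1.
Let d a := hamming m a b.
Let u T a : R := Num.max 0 (lam ^+ d a - r ^+ T).

Lemma walk_rate_gt0 : 0 < r.
Proof. by rewrite invr_gt0 ltr_wpDr// mulr_ge0// exprn_ge0. Qed.

(** Some literal of [c] is satisfied by [b]; choosing it decreases the distance, and each of the
    other s - 1 literals increases it by at most 1. With q = 2^-s and y = lam^(d-1), the gain over
    lam^d is at least y q (1 - lam) (1 - (s - 1) lam). Here 1 - lam >= lam, q >= 2^-k, and the last
    factor is at least eta because s <= k. *)
Lemma walk_drift (a : seq bool) (c : clause m) : c \in F -> ~~ clause_sat a c ->
  lam ^+ d a / r <=
    2^-1 ^+ size c * (\sum_(l <- c) lam ^+ d (set_lit a l)) +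
    (1 - (size c)%:R * 2^-1 ^+ size c) * lam ^+ d a.
Proof.
move=> cF ca; have lam2 : lam <= 1 - lam.
  by rewrite lerBrDr -mulr2n -mulr_natr -ler_pdivlMr// div1r.
set q := 2^-1 ^+ size c.
have /hasP[l lc lb] := allP b_sat _ cF.
have al : nth false a l.1 != l.2 by move: ca => /hasPn /(_ _ lc).
have dl : d a = (d (set_lit a l)).+1.
  by rewrite /d (@hamming_set_eq _ a b l.1 l.2) //; apply/esym/eqP.
set e := d (set_lit a l) in dl *.
have lam1 : lam <= 1 by apply: le_trans lam_le _; rewrite invf_le1// ler1n.
have S : lam ^+ e + ((size c)%:R - 1) * lam ^+ e.+2 <=
         \sum_(l <- c) lam ^+ d (set_lit a l).
  rewrite (big_rem _ lc) /= lerD2l.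
  have -> : (size c)%:R - 1 = (size (rem l c))%:R :> R.
    by rewrite size_rem// -[size c in LHS](prednK (n := size c)) ?subn1 -?natr1 ?addrK //; case: (c) lc.
  rewrite mulr_natl -[X in _ *+ X]count_predT -[X in X <= _]iter_addr_0 -big_const_seq.
  apply: ler_sum => l' _; apply: ler_wiXn2l; [exact: ltW|done|].
  by rewrite -dl; exact: hamming_set_le.
have q0 : 0 <= q by rewrite exprn_ge0.
apply: le_trans (lerD (ler_wpM2l q0 S) (lexx _)).
rewrite dl /r invrK.
have sk : (size c <= k)%N := size_le_k cF.
have qk : 2^-1 ^+ k <= q.
  by apply: ler_wiXn2l => //; rewrite invf_le1// ler1n.
have sk' : (size c)%:R <= k%:R :> R by rewrite ler_nat.
rewrite !exprS; set y := lam ^+ e.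
have y0 : 0 <= y by rewrite exprn_ge0// ltW.
have p0 : 0 <= (2^-1 : R) ^+ k by rewrite exprn_ge0.
have key : lam * (2^-1 ^+ k * eta) <= q * ((1 - lam) * (1 - ((size c)%:R - 1) * lam)).
  have h1 : eta <= 1 - ((size c)%:R - 1) * lam.
    have -> : eta = 1 - (k%:R - 1) * lam by rewrite lamE; ring.
    by rewrite lerB// ler_wpM2r ?lerB// ltW.
  have h2 : lam * eta <= (1 - lam) * (1 - ((size c)%:R - 1) * lam).
    by apply: ler_pM => //; exact: ltW.
  rewrite mulrCA; apply: ler_pM => //.
  by rewrite mulr_ge0// ltW.
rewrite -subr_ge0.
have -> : q * (y + ((size c)%:R - 1) * (lam * (lam * y))) +
   (1 - (size c)%:R * q) * (lam * y) - lam * y * (1 + 2^-1 ^+ k * eta) =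
   y * (q * ((1 - lam) * (1 - ((size c)%:R - 1) * lam)) - lam * (2^-1 ^+ k * eta)).
  by ring.
by rewrite mulr_ge0// subr_ge0.
Qed.

(* Induction step for the bound [u T a] on the success probability of a walk
   of [T] steps started at [a]. *)
Lemma walk_success_step T (a : seq bool) (c : clause m) :
  c \in F -> ~~ clause_sat a c ->
  u T.+1 a <= 2^-1 ^+ size c * (\sum_(l <- c) u T (set_lit a l)) +
              (1 - (size c)%:R * 2^-1 ^+ size c) * u T a.
Proof.
move=> cF ca; set q := 2^-1 ^+ size c.
have q0 : 0 <= q by rewrite exprn_ge0.
have sq : 0 <= 1 - (size c)%:R * q.
  rewrite subr_ge0 /q exprVn ler_pdivrMr ?exprn_gt0// mul1r.
  by rewrite -natrX ler_nat ltnW// ltn_expl.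
have u0 T' a' : 0 <= u T' a' by rewrite le_max lexx.
have ul T' a' : lam ^+ d a' - r ^+ T' <= u T' a' by rewrite le_max lexx orbT.
rewrite {1}/u ge_max; apply/andP; split.
  by rewrite addr_ge0// mulr_ge0// sumr_ge0.
(* If lam^d is at most r^(T+1), the claimed bound is nonpositive and there is nothing to prove. *)
have [hle|hlt] := leP (lam ^+ d a) (r ^+ T.+1).
  apply: (@le_trans _ _ 0); first by rewrite subr_le0.
  by rewrite addr_ge0// mulr_ge0// sumr_ge0.
apply: le_trans (_ : _ <= q * (\sum_(l <- c) (lam ^+ d (set_lit a l) - r ^+ T)) +
   (1 - (size c)%:R * q) * (lam ^+ d a - r ^+ T)) _; last first.
  by apply: lerD; apply: ler_wpM2l => //; apply: ler_sum => l _.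
rewrite sumrB big_const_seq count_predT iter_addr_0 -mulr_natl.
have := walk_drift cF ca; rewrite -/q.
have r0 := walk_rate_gt0.
have r1 : r <= 1 by rewrite invf_le1 ?lerDl ?mulr_ge0 ?exprn_ge0// ltr_wpDr// mulr_ge0// exprn_ge0.
(* The right-hand side is the left-hand side divided by r, and the left-hand side is positive while
   r <= 1. *)
have : lam ^+ d a - r ^+ T.+1 <= lam ^+ d a / r - r ^+ T.
  rewrite -(ler_pM2r r0) [leRHS]mulrBl divfK ?gt_eqF// -exprSr.
  rewrite -subr_ge0.
  have -> : lam ^+ d a - r ^+ T.+1 - (lam ^+ d a - r ^+ T.+1) * r =
            (lam ^+ d a - r ^+ T.+1) * (1 - r) by ring.
  by rewrite mulr_ge0// subr_ge0// ltW.
set S := \sum_(_ <- _) _; set X := lam ^+ d a; set Y := r ^+ T => h1 h2.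
lra.
Qed.

Variable n z0 : tree.
Let st a z go := mk [:: enc_bits a; enc_seq [seq enc_clause c | c <- F]; n; z0; z; go;
  Leaf; Leaf; Leaf; Leaf; Leaf; Leaf; Leaf; Leaf].

Hypothesis good_sat : forall a, size a = m -> cnf_sat a F -> good (st a Leaf Leaf).

(** A failed walk hands over to [restart], whose cost is assumed to be at most [V]; the failure
    probability is at most [1 - u T a]. *)
Lemma ev_walk N T a : size a = m ->
  (forall a', size a' = m -> E N ([:: restart], st a' Leaf (Node Leaf Leaf)) <= V) ->
  E N ([:: While (EVar vZ) walk_step; restart], st a (enc_nat T) (Node Leaf Leaf)) <=
    (T * (step_cost F L).+1 + 3)%:R + V * (1 - u T a).
Proof.
move=> sa hV.
have u1 T' a' : u T' a' <= 1.
  rewrite ge_max ler01 /= lerBlDr.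
  apply: (@le_trans _ _ 1); last by rewrite lerDl exprn_ge0// ltW// walk_rate_gt0.
  rewrite exprn_ile1//; first exact: ltW.
  by apply: le_trans lam_le _; rewrite invf_le1// ler1n.
elim: T a sa => [|T IH] a sa.
  have -> : u 0 a = 0.
    apply/max_idPl; rewrite expr0 subr_le0 exprn_ile1//; first exact: ltW.
    by apply: le_trans lam_le _; rewrite invf_le1// ler1n.
  apply: (@reach_ev_le 1 _ _ _ _ _ _ (hV _ sa)); first by runw; exact: reach_refl.
  by rewrite subr0 mulr1 lerD2r ler_nat.
have [ha|ha] := boolP (cnf_sat a F).
  have h0 : E N ([::], st a Leaf Leaf) <= 0.
    by case: N {hV IH} => [|N] //; rewrite /E evS /= good_sat.
  apply: (@reach_ev_le 1 _ _ _ _ _ _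
    (@ev_walk_step_sat _ F L n z0 size_le_L _ a _ N 2 ha _)).
  - by runw; exact: reach_refl.
  - apply: (@reach_ev_le 2 _ _ _ _ _ _ h0); last by rewrite addr0.
    by runw; runw; exact: reach_refl.
  - have : 0 <= V * (1 - u T.+1 a) by rewrite mulr_ge0// subr_ge0.
    have : ((step_cost F L) + 3 <= (T.+1 * (step_cost F L).+1 + 3))%N by nia.
    rewrite -(ler_nat R) natrD; lra.
(* [ev_walk_step_unsat] wants a bound at every list. The induction hypothesis covers length [m]; at
   other lengths the value itself serves as its bound. *)
pose v a' := if size a' == m then (T * (step_cost F L).+1 + 3)%:R + V * (1 - u T a')
  else E N ([:: While (EVar vZ) walk_step; restart], st a' (enc_nat T) (Node Leaf Leaf)).
have hv a' : E N ([:: While (EVar vZ) walk_step; restart],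
                  st a' (enc_nat T) (Node Leaf Leaf)) <= v a'.
  by rewrite /v; case: ifP => [/eqP/IH|_].
have [c [cF ca hc]] := @ev_walk_step_unsat _ F L n z0 size_le_L _ a Leaf (enc_nat T) N v ha hv.
have c0 : (0 < size c)%N by have := allP b_sat _ cF; case: (c).
apply: (@reach_ev_le 1 _ _ _ _ _ _ (hc c0)); first by runw; exact: reach_refl.
rewrite /v sa eqxx.
rewrite (eq_bigr (fun l => (T * (step_cost F L).+1 + 3)%:R + V * (1 - u T (set_lit a l)))); last first.
  move=> l _; rewrite size_set_nth sa (maxn_idPr (ltn_ord _)) eqxx//.
have := ler_wpM2l V_ge0 (walk_success_step T cF ca).
have hsum (x : R) : \sum_(l <- c) x = (size c)%:R * x.
  by rewrite big_const_seq count_predT iter_addr_0 mulr_natl.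
rewrite big_split /= -mulr_sumr sumrB !hsum mulr1.
have -> : (T.+1 * (step_cost F L).+1 + 3 =
           (step_cost F L).+1 + (T * (step_cost F L).+1 + 3))%N.
  by rewrite mulSn addnA.
rewrite (natrD _ (step_cost F L).+1) -[(step_cost F L).+1%:R]natr1.
set q := 2^-1 ^+ _; set s := (size c)%:R; set A := (_ + 3)%:R.
set sc := (step_cost F L)%:R.
set U := u T.+1 a; set S := \sum_(_ <- _) _; set U' := u T a => hU.
rewrite -subr_ge0; move: hU; rewrite -subr_ge0 => hU.
have -> : sc + 1 + A + V * (1 - U) - (1 + (sc + (q * (s * A + V * (s - S)) +
  (1 - s * q) * (A + V * (1 - U'))))) =
  V * (q * S + (1 - s * q) * U') - V * U by ring.
exact: hU.
Qed.

End WalkAnalysis.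

(** * Repeated rounds *)

Definition round_cost m (F : cnf m) (L T : nat) : nat :=
  (6 * m + T * (step_cost F L).+1 + 14)%N.

(** If a round costs c and succeeds with probability s, then c <= V s means c + V (1 - s) <= V.
    Induction on the truncation [N] turns this into a bound on the whole loop without assuming a
    finite expectation: the loop test uses up one unit of [N] before the next round. *)
Lemma ev_restart m (F : cnf m) L T (V : R) (h : seq bool -> R) N t :
  let st a z := mk [:: a; enc_seq [seq enc_clause c | c <- F]; enc_nat m; enc_nat T; z;
    Node Leaf Leaf; Leaf; Leaf; Leaf; Leaf; Leaf; Leaf; Leaf; Leaf] in
  0 <= V ->
  (forall N a, size a = m ->
    (forall a', size a' = m -> E N ([:: restart], st (enc_bits a') Leaf) <= V) ->
    E N ([:: While $vZ walk_step; restart], st (enc_bits a) (enc_nat T)) <=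
      (T * (step_cost F L).+1 + 3)%:R + V * (1 - h a)) ->
  (round_cost F L T)%:R <= V * ((\sum_(w : m.-tuple bool) h (rev w)) / 2 ^+ m) ->
  E N ([:: restart], st t Leaf) <= V.
Proof.
move=> st V_ge0 hwalk hV; elim: N t => [|N IH] t; first exact: V_ge0.
pose g a := (T * (step_cost F L).+1 + 7)%:R + V * (1 - h a).
have hg a r : size a = m ->
    E N ([:: vR ::= ENil ;; vZ ::= $vZ0 ;; While $vZ walk_step; restart],
      mk [:: enc_bits a; enc_seq [seq enc_clause c | c <- F]; enc_nat m; enc_nat T; Leaf;
        Node Leaf Leaf; Leaf; Leaf; Leaf; Leaf; Leaf; Leaf; r; Leaf]) <= g a.
  move=> sa.
  apply: (@reach_ev_le 4 _ _ _ _ _ _ (hwalk N a sa (fun a' _ => IH (enc_bits a')))).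
    by do 4 run1; exact: reach_refl.
  by rewrite addrA -natrD lerD2r ler_nat; lia.
set body := [:: vA ::= ENil ;; vP ::= $vN ;; sample ;; vR ::= ENil ;; vZ ::= $vZ0 ;;
     While $vZ walk_step; restart].
(* The missing unit pays for the test of the outer loop. *)
have hb : E N (body, st t Leaf) <= V - 1.
  apply: (@reach_ev_le 5 _ _ _ _ _ _ (ev_sample hg (acc := [::]) Leaf (erefl m))).
    by do 5 run1; exact: reach_refl.
  rewrite /g big_split /= -mulr_sumr sumrB !sumr_const card_tuple card_bool.
  rewrite natrX -[X in (X + _) / _]mulr_natr natrX.
  have -> : \sum_(w : m.-tuple bool) h (catrev w [::]) =
            \sum_(w : m.-tuple bool) h (rev w) by [].
  move: hV; rewrite /round_cost; set S := \sum_(_ : _) _.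
  have p0 : (2 ^+ m : R) != 0 by rewrite expf_neq0.
  have -> : ((T * (step_cost F L).+1 + 7)%:R * 2 ^+ m + V * (2 ^+ m - S)) / 2 ^+ m =
    (T * (step_cost F L).+1 + 7)%:R + V - V * (S / 2 ^+ m) by field.
  rewrite !natrD; lra.
rewrite /E evS /=; move: hb; rewrite /E; lra.
Qed.

End Simulation.

(** * Isoperimetry in the cube *)

Section Isoperimetry.
Variable R : realType.

(** Convexity of the power 1/th >= 1, applied at x^th and y^th, followed by raising both sides to
    the power th. *)
Lemma powR_concave (th u x y : R) : 0 < th <= 1 -> 0 <= u <= 1 -> 0 <= x -> 0 <= y ->
  u * x `^ th + (1 - u) * y `^ th <= (u * x + (1 - u) * y) `^ th.
Proof.
move=> /andP[th0 th1] /andP[u0 u1] x0 y0.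
have ith : 1 <= th^-1 by rewrite invf_ge1.
have := @convex_powR R th^-1 ith (Itv01 u0 u1) (x `^ th) (y `^ th).
rewrite !inE /= !in_itv /= !andbT => /(_ (powR_ge0 _ _) (powR_ge0 _ _)).
rewrite !convRE /= -!powRrM !divff ?gt_eqF// !powRr1//.
move=> h.
set z := u * x `^ th + _ in h *.
have z0 : 0 <= z by rewrite addr_ge0// mulr_ge0 ?powR_ge0// subr_ge0.
have -> : z = (z `^ th^-1) `^ th by rewrite -powRrM mulVf ?gt_eqF// powRr1.
apply: ge0_ler_powR => //; first exact: ltW.
  by rewrite nnegrE powR_ge0.
by rewrite nnegrE addr_ge0// mulr_ge0// subr_ge0.
Qed.

(** Both [a] and [b] are convex combinations of [p] and [q], with exchanged weights; the two
    concavity inequalities add up to the claim. *)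
Lemma powR_add_spread (th p q a b : R) : 0 < th <= 1 ->
  0 <= q -> q <= a -> a <= b -> a + b = p + q ->
  p `^ th + q `^ th <= a `^ th + b `^ th.
Proof.
move=> hth q0 qa ab abpq.
have [pq|pq] := eqVneq p q.
  have -> : a = q by lra.
  have -> : b = p by lra.
  by rewrite addrC.
have qp : 0 < p - q by move: pq; rewrite neq_lt => /orP[]; lra.
pose u := (b - q) / (p - q).
have u01 : 0 <= u <= 1.
  by rewrite divr_ge0 ?ler_pdivrMr//=; lra.
have v01 : 0 <= 1 - u <= 1 by lra.
have p0 : 0 <= p by lra.
have hb := powR_concave hth u01 p0 q0.
have ha := powR_concave hth v01 p0 q0.
have ub : u * p + (1 - u) * q = b by rewrite /u; field; rewrite gt_eqF.
have ua : (1 - u) * p + (1 - (1 - u)) * q = a by lra.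
rewrite ub in hb; rewrite ua in ha; lra.
Qed.

(** The constant that makes the two-point inequality below an equality at a = t^(1/th) b, where both
    terms of the maximum coincide. *)
Definition iso_rate (t th : R) : R := (1 + t) / (1 + t `^ th^-1) `^ th.

(** Put x = t^(1/th). If a < x b, then a + b <= (1 + x) b and monotonicity gives the second term.
    Otherwise, splitting a + b in the ratio 1 : x gives a more spread pair than (b, a), and
    [powR_add_spread] gives the first. *)
Lemma iso_rate_two_point (t th a b : R) : 0 < t <= 1 -> 0 < th <= 1 ->
  0 <= a <= b ->
  iso_rate t th * (a + b) `^ th <=
  Num.max (a `^ th + b `^ th) ((1 + t) * b `^ th).
Proof.
move=> /andP[t0 t1] hth /andP[a0 ab].
have /andP[th0 th1] := hth.
set x := t `^ th^-1.
have x0 : 0 < x by rewrite powR_gt0.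
have x1 : x <= 1.
  rewrite -[leRHS](powRr0 t) ger_powR ?t0//.
  by rewrite invr_ge0 ltW.
have xth : x `^ th = t by rewrite -powRrM mulVf ?gt_eqF// powRr1// ltW.
have y0 : 0 < (1 + x) `^ th by rewrite powR_gt0// addr_gt0.
rewrite le_max; have [h|h] := leP (x * b) a; apply/orP; [left|right]; last first.
  rewrite /iso_rate -/x mulrAC ler_pdivrMr// -mulrA ler_pM2l ?addr_gt0//.
  have b0 : 0 <= b by lra.
  have hx : 0 <= 1 + x by lra.
  rewrite -powRM//; apply: ge0_ler_powR; rewrite ?nnegrE ?mulr_ge0//; lra.
have x1' : 1 + x != 0 by rewrite gt_eqF// addr_gt0.
have spread := @powR_add_spread th ((a + b) / (1 + x)) ((a + b) * (x / (1 + x))) a b hth.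
have s0 : 0 <= a + b by lra.
have -> : iso_rate t th * (a + b) `^ th =
   ((a + b) / (1 + x)) `^ th + ((a + b) * (x / (1 + x))) `^ th.
  have hx0 : 0 <= x by exact: ltW.
  have hx1 : 0 <= (1 + x)^-1 by rewrite invr_ge0 addr_ge0.
  have hx2 : 0 <= x / (1 + x) by rewrite mulr_ge0.
  rewrite !powRM//.
  rewrite /iso_rate -/x xth.
  have -> : (1 + x)^-1 `^ th = ((1 + x) `^ th)^-1.
    by rewrite -powR_inv1 ?addr_ge0 ?ltW// powRAC powR_inv1// powR_ge0.
  by field; rewrite gt_eqF.
apply: spread => //.
- by rewrite mulr_ge0// divr_ge0 ?addr_ge0// ltW.
- by rewrite mulrA ler_pdivrMr ?addr_gt0//; lra.
- by field.
Qed.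

(** For 0 <= t <= 1 this is t^d(a, S), the distance being taken to the words of [S] of the same
    length as [a], and 0 if there are none. The recursive form suits induction on the dimension. *)
Fixpoint proximity (t : R) (S : pred (seq bool)) (a : seq bool) : R :=
  if a is x :: a' then
    Num.max (proximity t (fun w => S (x :: w)) a')
            (t * proximity t (fun w => S (~~ x :: w)) a')
  else (S [::])%:R.

Lemma hamming_cons m x y a b :
  hamming m.+1 (x :: a) (y :: b) = ((x != y) + hamming m a b)%N.
Proof. by rewrite /hamming big_ord_recl. Qed.

Lemma proximity_witness (t : R) (S : pred (seq bool)) a :
  proximity t S a = 0 \/ exists b, [/\ size b = size a, S b &
    proximity t S a = t ^+ hamming (size a) a b].
Proof.
elim: a S => [|x a IH] S /=.
  case hS: (S [::]); last by left.
  by right; exists [::]; split; rewrite // /hamming big_ord0.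
case: (leP (proximity t _ a)) => _.
  case: (IH (fun w => S (~~ x :: w))) => [->|[b [sb Sb ->]]].
    by left; rewrite mulr0.
  right; exists (~~ x :: b); split => //=; first by rewrite sb.
  by rewrite hamming_cons -exprS; case: (x).
case: (IH (fun w => S (x :: w))) => [->|[b [sb Sb ->]]]; first by left.
right; exists (x :: b); split => //=; first by rewrite sb.
by rewrite hamming_cons eqxx.
Qed.

(** On each half of the cube, the proximity dominates the one to the slice of [S] in that half, and
    t times the one to the opposite slice. Using both own slices gives the first term of the
    two-point maximum; using the larger slice for both halves gives the second. *)
Lemma iso_proximity (t th : R) n (S : pred (seq bool)) : 0 < t <= 1 -> 0 < th <= 1 ->
  iso_rate t th ^+ n * (\sum_(w : n.-tuple bool) S w)%:R `^ th <=
  \sum_(w : n.-tuple bool) proximity t S w.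
Proof.
move=> ht hth; have /andP[t0 t1] := ht; have /andP[th0 th1] := hth.
elim: n S => [|n IH] S.
  rewrite expr0 mul1r (sum_tuple0 (fun w => S w : nat)).
  rewrite (sum_tuple0 (proximity t S)) /=.
  by case: (S [::]); rewrite ?powR1// powR0// gt_eqF.
rewrite (@sum_tupleS _ n (fun w => proximity t S w)).
rewrite (@sum_tupleS _ n (fun w => S w : nat)) natrD.
have := IH (fun w => S (false :: w)); have := IH (fun w => S (true :: w)).
rewrite /=; set A := (\sum_(_ : _) _)%:R; set B := (\sum_(_ : _) _)%:R.
set PA := \sum_(_ : _) _; set PB := \sum_(_ : _) _.
set Q0 := \sum_(_ : _) _; set Q1 := \sum_(_ : _) _ => hA hB.
have hC0 : 0 < iso_rate t th.
  by rewrite divr_gt0 ?addr_gt0// powR_gt0// addr_gt0// powR_gt0.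
have hCn : 0 < iso_rate t th ^+ n by rewrite exprn_gt0.
have q01 : PB <= Q0 by apply: ler_sum => w _; rewrite le_max lexx.
have q02 : t * PA <= Q0 by rewrite mulr_sumr; apply: ler_sum => w _; rewrite le_max lexx orbT.
have q11 : PA <= Q1 by apply: ler_sum => w _; rewrite le_max lexx.
have q12 : t * PB <= Q1 by rewrite mulr_sumr; apply: ler_sum => w _; rewrite le_max lexx orbT.
have A0 : 0 <= A by rewrite ler0n.
have B0 : 0 <= B by rewrite ler0n.
rewrite exprSr -mulrA.
have key (a b pa pb : R) : 0 <= a <= b -> iso_rate t th ^+ n * a `^ th <= pa ->
   iso_rate t th ^+ n * b `^ th <= pb -> pa + pb <= Q0 + Q1 ->
   pb + t * pb <= Q0 + Q1 ->
   iso_rate t th ^+ n * (iso_rate t th * (a + b) `^ th) <= Q0 + Q1.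
  move=> hab ha hb h1 h2.
  apply: le_trans (ler_wpM2l (ltW hCn) (iso_rate_two_point ht hth hab)) _.
  rewrite maxEle; case: ifP => _.
    by apply: le_trans h2; rewrite mulrCA mulrDl mul1r lerD// ler_wpM2l// ltW.
  by apply: le_trans h1; rewrite mulrDr lerD.
have [BA|/ltW AB] := leP B A.
  by apply: (key B A PB PA) => //; rewrite ?B0//; lra.
by rewrite addrC; apply: (key A B PA PB) => //; rewrite ?A0//; lra.
Qed.

End Isoperimetry.

(** * Binary entropy *)

Section Entropy.
Variable R : realType.
Implicit Types p q x delta : R.

Lemma ln_lt_subr1 x : 0 < x -> x != 1 -> ln x < x - 1.
Proof.
move=> x0 x1; have lx : ln x != 0 by rewrite ln_eq0.
by have := expR_gt1Dx lx; rewrite lnK ?posrE//; lra.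
Qed.

Lemma ln2_gt0 : 0 < ln 2 :> R.
Proof. by rewrite ln_gt0// ltr1n. Qed.

Lemma entropy_mul_ln2 x :
  entropy x * ln 2 = - x * ln x - (1 - x) * ln (1 - x).
Proof. by rewrite /entropy /log2; field; rewrite gt_eqF// ln2_gt0. Qed.

Lemma entropy0 : entropy (0 : R) = 0.
Proof. by rewrite /entropy /log2 subr0 ln1; ring. Qed.

(** Gibbs' inequality bounds H(q) strictly by the cross entropy - q log p - (1 - q) log (1 - p). The
    latter is at most H(p), because ln p <= ln (1 - p). The case q = 0 is treated apart. *)
Lemma entropy_lt p q : 0 <= q -> q < p -> p <= 2^-1 -> entropy q < entropy p.
Proof.
move=> q0 qp p2; rewrite -(ltr_pM2r ln2_gt0) !entropy_mul_ln2.
have h2 : (2^-1 : R) + 2^-1 = 1 by field.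
have p0 : 0 < p by lra.
have p1 : 0 < 1 - p by lra.
have lnp : ln p < 0 by rewrite ln_lt0// p0/=; lra.
have ln1p : ln (1 - p) < 0 by rewrite ln_lt0// p1/=; lra.
move: q0; rewrite le_eqVlt => /orP[/eqP <-|q0].
  rewrite subr0 ln1 mulr0 subr0 oppr0 mul0r.
  by have := mulr_gt0 p0 (_ : 0 < - ln p); have := mulr_gt0 p1 (_ : 0 < - ln (1 - p));
    rewrite !oppr_gt0 lnp ln1p => /(_ isT) ? /(_ isT) ?; lra.
have q1 : 0 < 1 - q by lra.
have h (x y : R) : 0 < x -> 0 < y -> x != y -> x * (ln y - ln x) < y - x.
  move=> x0 y0 xy.
  have : ln (y / x) < y / x - 1.
    apply: ln_lt_subr1; first by rewrite divr_gt0.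
    by apply: contra_neq xy => h; rewrite -[y](divfK (lt0r_neq0 x0)) h mul1r.
  rewrite ln_div ?posrE// => hh.
  have -> : y - x = x * (y / x - 1) by field; rewrite gt_eqF.
  by rewrite ltr_pM2l.
have hq : q * (ln p - ln q) < p - q by apply: h => //; rewrite lt_eqF.
have : (1 - q) * (ln (1 - p) - ln (1 - q)) < 1 - p - (1 - q).
  by apply: h => //; rewrite neq_lt; apply/orP; right; lra.
have hl : ln p <= ln (1 - p) by rewrite ler_ln ?posrE//; lra.
have : 0 <= (p - q) * (ln (1 - p) - ln p) by rewrite mulr_ge0//; lra.
lra.
Qed.

Lemma entropy_inj : {in (`[0, 2^-1]%classic : set R) &, injective (@entropy R)}.
Proof.
move=> x y; rewrite !inE /= !in_itv /= => /andP[x0 x2] /andP[y0 y2] e.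
case: (ltgtP x y) => // h.
  by have := entropy_lt x0 h y2; rewrite e ltxx.
by have := entropy_lt y0 h x2; rewrite e ltxx.
Qed.

(** An explicit form of the convergence of H to 0 at 0. At x^2 the logarithmic term is 2 x^2 (- ln
    x), controlled by - ln x <= 1/x. *)
Lemma entropy_le_sqrt x : 0 < x -> x <= 2^-1 -> entropy (x ^+ 2) * ln 2 <= 3 * x.
Proof.
move=> x0 x2; have h2 : (2^-1 : R) + 2^-1 = 1 by field.
have xx : x ^+ 2 <= x by rewrite expr2 ler_piMr ?ltW//; lra.
have x1 : 0 < 1 - x ^+ 2 by lra.
rewrite entropy_mul_ln2 lnXn//.
have hx : - ln x <= x^-1.
  by rewrite -lnV ?posrE// ltW// ln_sublinear// invr_gt0.
have h1 : - ln (1 - x ^+ 2) <= (1 - x ^+ 2)^-1 - 1.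
  rewrite -lnV ?posrE//.
  have := @le_ln1Dx R ((1 - x ^+ 2)^-1 - 1); rewrite subrKC; apply.
  by rewrite ltrBrDr addNr invr_gt0.
have a : x ^+ 2 * (- ln x) <= x.
  apply: le_trans (ler_wpM2l (exprn_ge0 _ (ltW x0)) hx) _.
  by rewrite expr2 mulfK ?gt_eqF.
have b : (1 - x ^+ 2) * (- ln (1 - x ^+ 2)) <= x ^+ 2.
  apply: le_trans (ler_wpM2l (ltW x1) h1) _.
  by rewrite mulrBr divff ?gt_eqF// mulr1 opprB addrCA subrr addr0.
rewrite mulr2n; lra.
Qed.

Lemma entropy_continuous x : 0 < x < 1 -> {for x, continuous (@entropy R)}.
Proof.
move=> /andP[x0 x1]; rewrite /entropy /log2.
have c1 : {for x, continuous (fun y : R => ln y)} by exact: continuous_ln.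
have c2 : {for x, continuous (fun y : R => 1 - y)}.
  by apply: continuousB; [exact: cst_continuous|exact: cvg_id].
have c3 : {for x, continuous (fun y : R => ln (1 - y))}.
  apply: (@continuous_comp _ _ _ (fun y : R => 1 - y) (@ln R)) => //.
  by apply: continuous_ln; rewrite subr_gt0.
apply: (@continuousB _ _ _ (fun y : R => - y * (ln y / ln 2)) (fun y => (1 - y) * (ln (1 - y) / ln 2))).
  apply: (@continuousM _ _ (fun y : R => - y)); first by apply: continuousN; exact: cvg_id.
  by apply: (@continuousM _ _ (fun y : R => ln y)) => //; exact: cst_continuous.
apply: (@continuousM _ _ (fun y : R => 1 - y)) => //.
by apply: (@continuousM _ _ (fun y : R => ln (1 - y))) => //; exact: cst_continuous.
Qed.

Lemma entropy_surj a delta : 0 < a -> a <= 2^-1 -> 0 <= delta <= entropy a ->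
  exists2 x, 0 <= x <= a & entropy x = delta.
Proof.
move=> a0 a2 /andP[]; rewrite le_eqVlt => /orP[/eqP <- _|d0 da].
  by exists 0; rewrite ?entropy0 ?lexx ?ltW.
have h2 : (2^-1 : R) + 2^-1 = 1 by field.
(* By [entropy_le_sqrt] this choice gives H(s^2) <= delta, so that the intermediate value theorem is
   applied on [s^2, a], away from 0. *)
pose s := Num.min a (delta * ln 2 / 3).
have s0 : 0 < s by rewrite lt_min a0 divr_gt0 ?mulr_gt0 ?ln2_gt0.
have sa : s <= a by rewrite ge_min lexx.
have sd : 3 * s <= delta * ln 2 by rewrite mulrC -ler_pdivlMr// ge_min lexx orbT.
have ss : s ^+ 2 <= s by rewrite expr2 ler_piMr ?ltW//; lra.
have hs : entropy (s ^+ 2) <= delta.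
  rewrite -(ler_pM2r ln2_gt0); apply: le_trans sd.
  by apply: entropy_le_sqrt => //; lra.
have s20 : 0 < s ^+ 2 by rewrite exprn_gt0.
have s2a : s ^+ 2 <= a by lra.
have [||x] := @IVT R (@entropy R) (s ^+ 2) a delta s2a.
- apply: continuous_in_subspaceT => x; rewrite inE /= in_itv /= => /andP[x0 x1].
  by apply: entropy_continuous; lra.
- by rewrite ge_min hs /= le_max da orbT.
rewrite in_itv /= => /andP[x0 x1] <-; exists x => //.
by rewrite x1 andbT; lra.
Qed.

Lemma entropy_invP a delta : 0 < a -> a <= 2^-1 -> 0 <= delta <= entropy a ->
  0 <= entropy_inv delta <= a /\ entropy (entropy_inv delta) = delta.
Proof.
move=> a0 a2 /(entropy_surj a0 a2)[x /andP[x0 xa] <-].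
have -> : entropy_inv (entropy x) = x.
  apply: pinvKV; first exact: entropy_inj.
  by rewrite inE /= in_itv /= x0 (le_trans xa).
by rewrite x0 xa.
Qed.

End Entropy.

(** * Proximity to a set of given entropy *)

Section Proximity.
Variable R : realType.
Implicit Types p t : R.

(** The case p = 0 of the next bound, where y = p/(1 - p) has no logarithm. A single point of [S]
    already yields (1 + t)^n. *)
Lemma proximity_sum_ge t n (S : pred (seq bool)) : 0 <= t ->
  (0 < \sum_(w : n.-tuple bool) S w)%N ->
  (1 + t) ^+ n <= \sum_(w : n.-tuple bool) proximity t S w.
Proof.
move=> t0; elim: n S => [|n IH] S.
  rewrite (sum_tuple0 (fun w => S w : nat)) (sum_tuple0 (proximity t S)) /=.
  by case: (S [::]).
rewrite (@sum_tupleS _ n (fun w => proximity t S w)).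
rewrite (@sum_tupleS _ n (fun w => S w : nat)) addn_gt0.
have h (b : bool) : (0 < \sum_(w : n.-tuple bool) S (b :: w))%N ->
  (1 + t) ^+ n.+1 <= \sum_(w : n.-tuple bool) proximity t S (b :: w) +
                     \sum_(w : n.-tuple bool) proximity t S (~~ b :: w).
  move=> /(IH (fun w => S (b :: w))) h.
  rewrite exprS mulrDl mul1r; apply: lerD.
    by apply: le_trans h _; apply: ler_sum => w _ /=; rewrite le_max lexx.
  apply: le_trans (ler_wpM2l t0 h) _; rewrite mulr_sumr; apply: ler_sum => w _ /=.
  by rewrite negbK le_max lexx orbT.
by case/orP => [/h//|/h]; rewrite [leRHS]addrC.
Qed.

Lemma proximity_sum_entropy (t p delta : R) n (S : pred (seq bool)) :
  0 < t < 1 -> 0 <= p -> p * (1 + t) <= t -> entropy p = delta ->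
  2 `^ (delta * n%:R) <= (\sum_(w : n.-tuple bool) S w)%:R ->
  (1 + t) ^+ n * (t^-1 `^ (p * n%:R)) <= \sum_(w : n.-tuple bool) proximity t S w.
Proof.
move=> /andP[t0 t1] p0 pt hp hS.
move: p0; rewrite le_eqVlt => /orP[/eqP p0|p0].
  rewrite -p0 mul0r powRr0 mulr1; apply: proximity_sum_ge; first exact: ltW.
  by rewrite -(ltr0n R); apply: lt_le_trans hS; rewrite powR_gt0.
have p1 : 0 < 1 - p.
  rewrite subr_gt0; apply: le_lt_trans t1; apply: le_trans pt.
  by rewrite ler_peMr ?ltW// ltrDl.
pose y := p / (1 - p).
have y0 : 0 < y by rewrite divr_gt0.
have yt : y <= t by rewrite ler_pdivrMr//; lra.
have lt0 : ln t < 0 by rewrite ln_lt0// t0.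
have lyt : ln y <= ln t by rewrite ler_ln ?posrE.
have ly0 : ln y < 0 by exact: le_lt_trans lt0.
(* Chosen so that t^(1/th) = y = p/(1 - p); th <= 1 because y <= t < 1. *)
pose th := ln t / ln y.
have th0 : 0 < th by rewrite /th ltr_ndivlMr// mul0r.
have th1 : th <= 1 by rewrite ler_ndivrMr// mul1r.
have ht : 0 < t <= 1 by rewrite t0 ltW.
have hth : 0 < th <= 1 by rewrite th0.
apply: le_trans (iso_proximity n S ht hth).
have ity : t `^ th^-1 = y.
  rewrite /powR gt_eqF// /th invf_div divfK ?lt_eqF//; exact: lnK.
apply: (@le_trans _ _ (iso_rate t th ^+ n * (2 `^ (delta * n%:R)) `^ th)); last first.
  have r0 : 0 <= iso_rate t th.
    by rewrite divr_ge0 ?powR_ge0// addr_ge0// ltW.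
  apply: ler_wpM2l; first exact: exprn_ge0.
  by apply: ge0_ler_powR => //; rewrite ?nnegrE ?powR_ge0 ?ler0n// ltW.
rewrite /iso_rate ity.
have -> : 1 + y = (1 - p)^-1 by rewrite /y; field; rewrite gt_eqF.
rewrite expr_div_n -mulrA ler_pM2l ?exprn_gt0 ?addr_gt0//.
have e0 : t^-1 `^ (p * n%:R) = expR (- (p * ln t) *+ n).
  by rewrite /powR gt_eqF ?invr_gt0// lnV ?posrE// -mulr_natr; congr expR; ring.
have e1 : (((1 - p)^-1 `^ th) ^+ n)^-1 = expR (th * ln (1 - p) *+ n).
  rewrite -exprVn /powR gt_eqF ?invr_gt0// lnV ?posrE// -expRN mulrN opprK.
  by rewrite -expRM_natl mulr_natl.
have e2 : (2 `^ (delta * n%:R)) `^ th = expR (th * (delta * ln 2) *+ n).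
  rewrite -powRrM /powR gt_eqF// -mulr_natr; congr expR; ring.
(* The two sides are in fact equal: H(p) ln 2 + ln (1 - p) = - p ln y, and th ln y = ln t. *)
rewrite e0 e1 e2 -expRD -mulrnDl le_eqVlt; apply/orP; left; apply/eqP.
congr expR; congr (_ *+ n).
rewrite -hp entropy_mul_ln2 -mulrDr.
have -> : ln (1 - p) + (- p * ln p - (1 - p) * ln (1 - p)) = - p * (ln p - ln (1 - p)) by ring.
rewrite -ln_div ?posrE// -/y /th; field; rewrite lt_eqF//.
Qed.

End Proximity.

(** * Cost estimates *)

Lemma cnf_sat_finfun n (F : cnf n) (w : seq bool) :
  satisfies [ffun i : 'I_n => nth false w i] F = cnf_sat w F.
Proof.
by apply: eq_all => c; apply: eq_has => l; rewrite /lit_sat ffunE.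
Qed.

Lemma enc_assignment_finfun n (w : seq bool) : size w = n ->
  enc_assignment [ffun i : 'I_n => nth false w i] = enc_bits w.
Proof.
move=> sw; rewrite /enc_assignment /enc_bits; congr enc_seq.
rewrite -[in RHS](mkseq_nth false w) sw /mkseq -val_enum_ord -!map_comp.
by apply: eq_map => i /=; rewrite ffunE.
Qed.

Lemma card_sat n (F : cnf n) :
  #|sat F| = (\sum_(w : n.-tuple bool) cnf_sat w F)%N.
Proof.
rewrite -sum1_card big_mkcond /=.
rewrite (reindex (fun w : n.-tuple bool => [ffun i : 'I_n => nth false w i])) /=.
  apply: eq_bigr => w _; rewrite inE cnf_sat_finfun; by case: cnf_sat.
exists (fun a : {ffun 'I_n -> bool} => [tuple a i | i < n]) => [w _|a _].
  by apply: eq_from_tnth => i; rewrite tnth_mktuple ffunE (tnth_nth false).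
by apply/ffunP => i; rewrite ffunE -tnth_nth tnth_mktuple.
Qed.

Lemma sum_tuple_rev (V : nmodType) n (f : seq bool -> V) :
  \sum_(w : n.-tuple bool) f (rev w) = \sum_(w : n.-tuple bool) f w.
Proof.
rewrite [RHS](reindex_inj (h := fun w : n.-tuple bool => [tuple of rev w])) //.
by move=> w w' /(congr1 val) /= /(can_inj revK) /val_inj.
Qed.

Lemma tree_size_gt0 t : (0 < tree_size t)%N.
Proof. by case: t. Qed.

Lemma size_le_tree_size (s : seq tree) : (size s <= tree_size (enc_seq s))%N.
Proof. by elim: s => //= t s IH; have := tree_size_gt0 t; lia. Qed.

Lemma dim_le_input_size n (F : cnf n) : (n <= input_size F)%N.
Proof.
rewrite -[leqLHS](size_nseq n Leaf); apply: leq_trans (size_le_tree_size _) _.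
by apply: leqW; exact: leq_addr.
Qed.

Lemma size_le_input_size n (F : cnf n) : (size F <= input_size F)%N.
Proof.
rewrite -(size_map (@enc_clause n)); apply: leq_trans (size_le_tree_size _) _.
by apply: leqW; exact: leq_addl.
Qed.

Lemma clause_size_le_input_size n (F : cnf n) c :
  c \in F -> (size c <= input_size F)%N.
Proof.
move=> cF; apply: (@leq_trans (tree_size (enc_seq [seq enc_clause c | c <- F]))).
  elim: F cF => //= c' F IH; rewrite in_cons => /orP[/eqP <-|/IH h].
    rewrite -(size_map (@enc_literal n)); apply: leq_trans (size_le_tree_size _) _.
    by apply: leqW; exact: leq_addr.
  by apply: leq_trans h _; apply: leqW; exact: leq_addl.
by apply: leqW; exact: leq_addl.
Qed.

Section Numeric.
Variable R : realType.

Lemma bernoulli_ge (x : R) n : -1 <= x -> 1 + n%:R * x <= (1 + x) ^+ n.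
Proof.
move=> x1; elim: n => [|n IH]; first by rewrite mul0r addr0 expr0.
have x0 : 0 <= 1 + x by lra.
rewrite exprS; apply: le_trans (ler_wpM2l x0 IH).
have : 0 <= n%:R * x ^+ 2 by rewrite mulr_ge0// exprn_even_ge0.
by rewrite -[n.+1%:R]natr1 expr2; lra.
Qed.

(** With x = 1 / (2^(k+1) (n+1)), Bernoulli's inequality shows that 2^(k+1) (n+1) steps gain a
    factor 2. Repeating this k (n+1) times gives 2^(k n) 2^k >= (k - 1)^n 4. *)
Lemma horizon_small k n : (2 <= k)%N ->
  (1 + 2^-1 ^+ k * (2 * n.+1%:R)^-1)^-1 ^+ (k * 2 ^ k.+1 * n.+1 * n.+1) <=
  (k%:R - 1)^-1 ^+ n / 4 :> R.
Proof.
move=> k2; set x : R := 2^-1 ^+ k * (2 * n.+1%:R)^-1.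
have x0 : 0 < x by rewrite mulr_gt0// ?exprn_gt0 ?invr_gt0 ?mulr_gt0 ?ltr0n.
have k1 : 0 < k%:R - 1 :> R by rewrite subr_gt0 ltr1n.
have h2 : 2 <= (1 + x) ^+ (2 ^ k.+1 * n.+1).
  apply: le_trans (bernoulli_ge _ _); last by lra.
  have -> : (2 ^ k.+1 * n.+1)%:R * x = 1.
    have a0 : (2 ^+ k : R) != 0 by rewrite expf_neq0.
    have b0 : (n.+1%:R : R) != 0 by rewrite pnatr_eq0.
    rewrite /x natrM natrX exprVn exprS; move: a0 b0.
    by set a := 2 ^+ k; set b := n.+1%:R => a0 b0; field; rewrite ?a0 ?b0 ?andbT.
  lra.
rewrite !exprVn -invfM lef_pV2 ?posrE ?mulr_gt0 ?exprn_gt0//; last by lra.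
have -> : (k * 2 ^ k.+1 * n.+1 * n.+1 = 2 ^ k.+1 * n.+1 * (k * n.+1))%N by ring.
rewrite exprM; apply: (@le_trans _ _ (2 ^+ (k * n.+1))); last first.
  by rewrite lerXn2r ?nnegrE// exprn_ge0//; lra.
rewrite mulnS addnC exprD; apply: ler_pM => //.
- by rewrite exprn_ge0// ltW.
- rewrite exprM lerXn2r ?nnegrE ?exprn_ge0 ?(ltW k1)//.
  by rewrite lerBlDr -natrX natr1 ler_nat ltnW// ltnS ltnW// ltn_expl.
- by rewrite -natrX ler_nat (_ : 4 = 2 ^ 2)%N// leq_exp2l.
Qed.

End Numeric.

(** Setup plus four rounds, [k] standing for the constant [C] of the program. The coefficients are
    388 = 4 * 97 and 101 = 21 + 4 * (6 + 14), every lower power of [I.+1] being raised to the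
    fifth. *)
Lemma cost_le k n sF I : (n <= I)%N -> (sF <= I)%N ->
  (setup_cost n + 4 * (6 * n + k * n.+1 * n.+1 *
    (((4 * n + 24) * I + 12) * sF + 10 * I + 10 * n + 40).+1 + 14) <=
   (388 * k + 101) * I.+1 ^ 5)%N.
Proof.
move=> nI sI.
have h1 : ((((4 * n + 24) * I + 12) * sF + 10 * I + 10 * n + 40).+1 <= 97 * I.+1 ^ 3)%N.
  apply: (@leq_trans ((((4 * I + 24) * I + 12) * I + 10 * I + 10 * I + 40).+1)).
    rewrite ltnS !leq_add// ?leq_mul// ?leq_add// ?leq_mul// ?leq_add// ?leq_mul//.
  by rewrite !expnS expn0; nia.
have h2 : (k * n.+1 * n.+1 * (((4 * n + 24) * I + 12) * sF + 10 * I + 10 * n + 40).+1 <=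
           k * I.+1 * I.+1 * (97 * I.+1 ^ 3))%N.
  by rewrite !leq_mul.
set X := (_ * _.+1)%N in h2 *.
have h3 : (setup_cost n <= 21 * I.+1 ^ 2)%N.
  by rewrite /setup_cost; apply: (@leq_trans ((4 * I + 11) * I.+1 + 10)); nia.
have p0 : (0 < I.+1)%N by [].
have p5 j : (j <= 5)%N -> (I.+1 ^ j <= I.+1 ^ 5)%N by move=> j5; exact: leq_pexp2l.
have h4 := p5 1%N isT; have h5 := p5 2 isT; have h6 := p5 0%N isT.
rewrite expn1 in h4; rewrite expn0 in h6.
have h7 : (k * I.+1 * I.+1 * (97 * I.+1 ^ 3) = 97 * k * I.+1 ^ 5)%N by rewrite !expnS expn0; ring.
rewrite h7 in h2.
rewrite mulnDl; set Y := (I.+1 ^ 5)%N in h2 h4 h5 h6 *.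
have -> : (388 * k * Y = 4 * (97 * k * Y))%N by ring.
set Z := (97 * k * Y)%N in h2 *.
lia.
Qed.

(** * Assembly of the running time bound *)

Lemma ev_schoening_le (R : realType) (k n : nat) (F : cnf n) (delta M : R) (N : nat) :
  (3 <= k)%N -> 0 <= M ->
  is_kcnf k F ->
  0 <= delta <= entropy (k%:R^-1) ->
  2 `^ (delta * n%:R) <= #|sat F|%:R ->
  ev (fun s => `[< exists2 a, a \in sat F & s 0%N = enc_assignment a >]) M N
    (init (schoening (k * 2 ^ k.+1)) (enc_cnf F)) <=
  (388 * (k * 2 ^ k.+1) + 101)%:R * ((input_size F).+1%:R) ^+ 5 *
  ((2 * (k%:R - 1) / k%:R) ^+ n * (k%:R - 1) `^ (- (entropy_inv delta * n%:R))).
Proof.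
move=> k3 M0 /allP kF hdelta hsat; set good := fun s => _.
have k3R : 3 <= k%:R :> R by rewrite ler_nat.
pose t : R := (k%:R - 1)^-1.
have k0 : 0 < k%:R - 1 :> R by lra.
have t0 : 0 < t by rewrite invr_gt0.
have th : t <= 2^-1 by rewrite lef_pV2 ?posrE//; lra.
have h2 : (2^-1 : R) < 1 by rewrite invf_lt1// ltr1n.
have t1 : t < 1 by exact: le_lt_trans h2.
have kV : k%:R^-1 <= (2^-1 : R) by rewrite lef_pV2 ?posrE//; lra.
have kV0 : 0 < (k%:R^-1 : R) by rewrite invr_gt0; lra.
have [/andP[p0 pk] hp] := entropy_invP kV0 kV hdelta.
set p := entropy_inv delta in p0 pk hp *.
pose S : pred (seq bool) := fun w => cnf_sat w F.
have onet : 1 + t = k%:R / (k%:R - 1) by rewrite /t; field; rewrite gt_eqF.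
(* As 1 + t = k t, this is p <= 1/k. *)
have pt : p * (1 + t) <= t.
  rewrite onet mulrA ler_pdivrMr// mulVf ?gt_eqF// -ler_pdivlMr ?div1r//; lra.
have hS : 2 `^ (delta * n%:R) <= (\sum_(w : n.-tuple bool) S w)%:R :> R.
  by rewrite -card_sat.
have ht01 : 0 < t < 1 by rewrite t0.
have hiso := proximity_sum_entropy ht01 p0 pt hp hS.
rewrite invrK in hiso.
set Pr := \sum_(w : n.-tuple bool) proximity t S w in hiso.
pose B := (2 * (k%:R - 1) / k%:R) ^+ n * (k%:R - 1) `^ (- (p * n%:R)).
rewrite -/B.
have kn0 : (k%:R : R) != 0 by rewrite gt_eqF//; lra.
have BV : B^-1 = (1 + t) ^+ n * (k%:R - 1) `^ (p * n%:R) / 2 ^+ n.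
  rewrite /B powRN invfM invrK onet [RHS]mulrAC -[in RHS]expr_div_n -exprVn; congr (_ ^+ _ * _).
  by field; rewrite kn0 gt_eqF.
have B0 : 0 < B.
  by rewrite mulr_gt0 ?exprn_gt0 ?powR_gt0 ?divr_gt0 ?mulr_gt0//; lra.
(* For a uniform start, the mean of t^d is at least 1/B. *)
have BPr : B^-1 <= Pr / 2 ^+ n by rewrite BV ler_pM2r// invr_gt0 exprn_gt0.
have prox1 a : proximity t S a <= 1.
  case: (proximity_witness t S a) => [->|[b [_ _ ->]]]; first exact: ler01.
  by rewrite exprn_ile1// ltW.
have B1 : 1 <= B.
  rewrite -invf_le1//; apply: le_trans BPr _.
  rewrite ler_pdivrMr ?exprn_gt0// mul1r.
  apply: (@le_trans _ _ (\sum_(w : n.-tuple bool) 1)); first exact: ler_sum.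
  by rewrite sumr_const card_tuple card_bool natrX.
(* Allows the error r^T, which [horizon_small] compares with t^n, to be compared with 1/B. *)
have tB : t ^+ n <= B^-1.
  rewrite BV -[leLHS]mulr1 mulrAC -expr_div_n; apply: ler_pM => //.
  - by rewrite exprn_ge0// ltW.
  - have tt : t <= (1 + t) / 2 by lra.
    by rewrite lerXn2r// nnegrE ?(le_trans _ tt) ?ltW.
  - have k1 : 1 <= k%:R - 1 :> R by lra.
    by have := ler_powR k1 (mulr_ge0 p0 (ler0n R n)); rewrite powRr0.
(* Then n eta <= 1/2, so that (1 - eta)^d >= 1/2 for all d <= n by Bernoulli's inequality. *)
pose eta : R := (2 * n.+1%:R)^-1.
pose lam := t * (1 - eta).
have eta0 : 0 < eta by rewrite invr_gt0 mulr_gt0// ltr0n.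
have etan : n%:R * eta <= 2^-1.
  rewrite /eta ler_pdivrMr ?mulr_gt0 ?ltr0n// mulrA mulVf// mul1r.
  by rewrite ler_nat.
have eta1 : eta <= 2^-1.
  by rewrite lef_pV2 ?posrE ?mulr_gt0 ?ltr0n// ler_pMr// ler1n.
have lam0 : 0 < lam by rewrite mulr_gt0//; lra.
have lamt : lam <= t by rewrite ler_piMr// ?ltW//; lra.
have lamE : (k%:R - 1) * lam = 1 - eta.
  by rewrite /lam mulrA divff ?gt_eqF// mul1r.
have lampow d : (d <= n)%N -> t ^+ d / 2 <= lam ^+ d.
  move=> dn; rewrite /lam exprMn ler_pM2l ?exprn_gt0//.
  have := @bernoulli_ge R (- eta) d; rewrite mulrN => hb.
  apply: le_trans (hb _); last by lra.
  have : d%:R * eta <= n%:R * eta by rewrite ler_wpM2r ?ler_nat// ltW.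
  have : (2^-1 : R) + 2^-1 = 1 by field.
  lra.
set C := (k * 2 ^ k.+1)%N.
pose T := (C * n.+1 * n.+1)%N.
pose r : R := (1 + 2^-1 ^+ k * eta)^-1.
have rT : r ^+ T <= B^-1 / 4.
  have := @horizon_small R k n (ltnW k3); rewrite -/C -/T -/eta -/r -/t => h.
  by apply: le_trans h _; rewrite ler_pM2r// invr_gt0.
have r0 : 0 < r by rewrite invr_gt0 ltr_wpDr// mulr_ge0 ?exprn_ge0 ?ltW.
pose h a : R := proximity t S a / 2 - r ^+ T.
pose L := input_size F.
pose rc := round_cost F L T.
(* The mean of [h] is at least 1/(2B) - 1/(4B) = 1/(4B), so this is the least value given by the
   criterion c <= V s with s = 1/(4B). *)
pose V := 4 * rc%:R * B.
have V0 : 0 <= V by exact: mulr_ge0 (mulr_ge0 (ler0n R 4) (ler0n R rc)) (ltW B0).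
have size_le_k (c : clause n) : c \in F -> (size c <= k)%N by move=> /kF.
have size_le_L (c : clause n) : c \in F -> (size c <= L)%N.
  by move=> cF; exact: clause_size_le_input_size.
(* Serves the degenerate alternative of [proximity_witness]: when the proximity is 0, [h] is
   nonpositive and any solution will do. *)
have [a0 a0S] : exists a0 : n.-tuple bool, S a0.
  case: (pickP (fun w : n.-tuple bool => S w)) => [w Sw|hn]; first by exists w.
  by move: hS; rewrite big1 => [|w _]; rewrite ?hn// leNgt powR_gt0.
have hwalk N' a : size a = n ->
    (forall a', size a' = n -> ev good M N' ([:: restart],
      mk [:: enc_bits a'; enc_seq [seq enc_clause c | c <- F]; enc_nat n; enc_nat T; Leaf;
        Node Leaf Leaf; Leaf; Leaf; Leaf; Leaf; Leaf; Leaf; Leaf; Leaf]) <= V) ->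
    ev good M N' ([:: While (EVar 4) walk_step; restart],
      mk [:: enc_bits a; enc_seq [seq enc_clause c | c <- F]; enc_nat n; enc_nat T; enc_nat T;
        Node Leaf Leaf; Leaf; Leaf; Leaf; Leaf; Leaf; Leaf; Leaf; Leaf]) <=
      (T * (step_cost F L).+1 + 3)%:R + V * (1 - h a).
  move=> sa hV.
  have hgood a' : size a' = n -> cnf_sat a' F ->
      good (mk [:: enc_bits a'; enc_seq [seq enc_clause c | c <- F]; enc_nat n; enc_nat T;
        Leaf; Leaf; Leaf; Leaf; Leaf; Leaf; Leaf; Leaf; Leaf; Leaf]).
    move=> sa' ha'; apply/asboolP; exists [ffun i : 'I_n => nth false a' i].
      by rewrite inE cnf_sat_finfun.
    by rewrite enc_assignment_finfun.
  have hb (b : seq bool) : S b -> h a <= Num.max 0 (lam ^+ hamming n a b - r ^+ T) ->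
      ev good M N' ([:: While (EVar 4) walk_step; restart],
      mk [:: enc_bits a; enc_seq [seq enc_clause c | c <- F]; enc_nat n; enc_nat T; enc_nat T;
        Node Leaf Leaf; Leaf; Leaf; Leaf; Leaf; Leaf; Leaf; Leaf; Leaf]) <=
      (T * (step_cost F L).+1 + 3)%:R + V * (1 - h a).
    move=> Sb hle.
    apply: le_trans (ev_walk M0 size_le_k size_le_L Sb lam0 (le_trans lamt th)
      (ltW eta0) lamE V0 hgood T sa hV) _.
    by rewrite lerD2l ler_wpM2l// lerB.
  case: (proximity_witness t S a) => [pa|[b [sb Sb pa]]].
    apply: (hb a0) => //; rewrite le_max /h pa mul0r sub0r oppr_le0.
    by rewrite exprn_ge0// ltW.
  apply: (hb b) => //; rewrite le_max /h pa sa lerD2r lampow ?orbT//.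
  rewrite /hamming -[leqRHS]card_ord -sum1_card; apply: leq_sum => i _.
  by case: (_ != _).
have hround : rc%:R <= V * ((\sum_(w : n.-tuple bool) h (rev w)) / 2 ^+ n).
  rewrite sum_tuple_rev /h sumrB -mulr_suml -/Pr sumr_const card_tuple card_bool.
  rewrite -[r ^+ T *+ _]mulr_natr natrX mulrBl mulfK ?expf_neq0//.
  have : B^-1 / 4 <= Pr / 2 / 2 ^+ n - r ^+ T.
    rewrite mulrAC; move: BPr; set Q := Pr / 2 ^+ n; lra.
  move=> /(ler_wpM2l V0); apply: le_trans.
  rewrite /V -[leRHS]mulrA [B * _]mulrA divff ?gt_eqF// mul1r mulrAC divff//.
  by rewrite mul1r.
have := ev_restart M0 N (enc_cnf F) V0 hwalk hround.
move=> /(reach_ev (reach_setup good M0 C F)) hev.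
apply: le_trans hev _.
have hc := @cost_le C n (size F) L (dim_le_input_size F) (size_le_input_size F).
(* Since B >= 1, the setup cost may be multiplied by B as well. *)
apply: (@le_trans _ _ ((setup_cost n + 4 * rc)%:R * B)).
  rewrite natrD mulrDl natrM /V lerD2r ler_peMr//.
by rewrite ler_pM2r// -natrX -natrM ler_nat; exact: hc.
Qed.

Theorem theorem10 (R : realType) (k : nat) (k_ge3 : (3 <= k)%N) :
  exists (A : cmd) (p : {poly R}),
    forall (n : nat) (F : cnf n) (delta : R),
      is_kcnf k F ->
      0 <= delta <= entropy (k%:R^-1) ->
      2 `^ (delta * n%:R) <= #|sat F|%:R ->
      finds_solution A F /\
      (expected_time R (init A (enc_cnf F)) <=
       (p.[(input_size F)%:R] *
        ((2 * (k%:R - 1) / k%:R) ^+ n *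
         (k%:R - 1) `^ (- (entropy_inv delta * n%:R))))%:E)%E.
Proof.
exists (schoening (k * 2 ^ k.+1)).
exists ((388 * (k * 2 ^ k.+1) + 101)%:R *: ('X + 1) ^+ 5).
move=> n F delta kF hdelta hsat.
rewrite hornerZ horner_exp hornerD hornerX hornerC natr1.
have hV M N M0 := @ev_schoening_le R k n F delta M N k_ge3 M0 kF hdelta hsat.
move: hV; set V := (X in (_ <= X%:E)%E) => hV.
split; last by apply: expected_time_le => N; exact: hV.
move=> w hw; apply/asboolP; apply: contraT => bad.
have V0 : 0 <= V by apply: le_trans (hV 0 0%N (lexx 0)); rewrite ev_ge0.
(* With this penalty, a run on [w] that halts without a solution would force V + 1 <= V. *)
have M0 : 0 <= (V + 1) * 2 ^+ size w by rewrite mulr_ge0 ?exprn_ge0 ?addr_ge0.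
have := le_trans (ev_bad M0 hw bad) (hV _ _ M0).
by rewrite mulfK ?expf_neq0// gerDl ler10.
Qed.
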